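(* Let $n\ge 1$ and $L\ge 1$ be integers, let $\mathbb{R}_+=[0,\infty)$, and let $F=(f_1,\ldots,f_L):\mathbb{R}_+^L\to\mathbb{R}_+^L$ be continuous on $\mathbb{R}_+^L$ and locally Lipschitz in the interior of $\mathbb{R}_+^L$. Assume that $F$ is non-degenerate. Assume also that for every $R>0$ the Dirichlet problem $$-\Delta u_i=f_i(u)\ \text{ in } B_R,\qquad u_i>0\ \text{ in } B_R,\qquad u_i=0\ \text{ on }\partial B_R,\qquad i=1,\ldots,L,$$ where $B_R=\{x\in\mathbb{R}^n: |x|<R\}$, admits no radially symmetric solution. Then the system $$-\Delta u_i=f_i(u)\ \text{ in }\mathbb{R}^n,\qquad u_i>0\ \text{ in }\mathbb{R}^n,\qquad i=1,\ldots,L,$$ admits a radially symmetric solution. Furthermore, if in addition $F(u)\neq 0$ for all sufficiently small $u>0$ (that is, there is $\varepsilon>0$ such that $F(u)\ne 0$ for every $u\in\mathbb{R}_+^L$ with $u>0$ and $|u|<\varepsilon$), then this system on $\mathbb{R}^n$ admits a radially symmetric solution $u(r)$, $r=|x|$, such that $u(r)\to 0$ as $r\to\infty$.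
   Context: For $u\in\mathbb{R}^L$, $u>0$ means that all components are positive: $u_i>0$ for $i=1,\ldots,L$. Non-degenerate (also called non-reducible): $F=(f_1,\ldots,f_L)$ is non-degenerate if for any permutation $i_1,\ldots,i_L$ of $1,\ldots,L$, any $1\le k<L$, and any $u\in\mathbb{R}_+^L$ with $u_{i_1}>0,\ldots,u_{i_k}>0$ and $u_{i_{k+1}}=\cdots=u_{i_L}=0$, one has $f_{i_{k+1}}(u)+\cdots+f_{i_L}(u)>0$. Solutions are understood in the classical sense: $u_i\in C^2(\mathbb{R}^n)$ for the system on $\mathbb{R}^n$, and $u_i\in C^2(B_R)\cap C(\overline{B_R})$ for the Dirichlet problem on $B_R$. Radially symmetric means that every $u_i(x)$ depends only on $|x|$. *)

(* Defs.v *)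
(* MathComp-Analysis; the reals are an arbitrary [R : realType]. *)
From HB Require Import structures.
From mathcomp Require Import all_boot all_order all_algebra all_fingroup.
From mathcomp Require Import all_classical all_reals all_analysis.

Set Implicit Arguments.
Unset Strict Implicit.
Unset Printing Implicit Defensive.

Import Order.TTheory GRing.Theory Num.Theory.
Import numFieldNormedType.Exports.

Local Open Scope classical_set_scope.
Local Open Scope ring_scope.

Section Domain.
Variables (R : realType) (n : nat).
Implicit Types (x : 'rV[R]_n) (w : 'rV[R]_n -> R) (A : set 'rV[R]_n).

(* The library norm `|x| on row vectors is the sup norm, so the Euclidean
   norm is defined separately; both induce the same topology. *)
Definition enorm x : R := Num.sqrt (\sum_(j < n) x 0 j ^+ 2).

Definition eball (r : R) : set 'rV[R]_n := [set x | enorm x < r].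

Definition boundary A : set 'rV[R]_n := closure A `\` A°.

Definition partial (j : 'I_n) w : 'rV[R]_n -> R := 'D_(delta_mx 0 j) w.

(* Only meant for open A: the (two-sided) derivatives and the pointwise
   continuity below then depend only on the values of w on A. *)
Definition C2_on A w : Prop :=
  forall x, A x ->
    [/\ {for x, continuous w},
        forall j, derivable w x (delta_mx 0 j) /\
                  {for x, continuous (partial j w)}
      & forall j k, derivable (partial j w) x (delta_mx 0 k) /\
                    {for x, continuous (partial k (partial j w))}].

Definition laplacian w x : R := \sum_(j < n) partial j (partial j w) x.

End Domain.

Section Nonlinearity.
Variables (R : realType) (L : nat).
Implicit Types (u : 'rV[R]_L) (F : 'rV[R]_L -> 'rV[R]_L).

Definition orthant : set 'rV[R]_L := [set u | forall i, 0 <= u 0 i].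

Definition all_pos u : Prop := forall i, 0 < u 0 i.

(* The library notation for local Lipschitz continuity on A quantifies over
   neighbourhoods of arbitrary pairs in A * A; here it is neighbourhoods of
   points of A. *)
Definition locally_lipschitz_on (A : set 'rV[R]_L) F : Prop :=
  forall u, A u -> exists2 U, nbhs u U & [lipschitz F v | v in U].

(* With 0-based indices, i_1, ..., i_L is s 0, ..., s (L - 1). *)
Definition non_degenerate F : Prop :=
  forall (s : 'S_L) (k : nat) u, (1 <= k < L)%N -> orthant u ->
    (forall j : 'I_L, (j < k)%N -> 0 < u 0 (s j)) ->
    (forall j : 'I_L, (k <= j)%N -> u 0 (s j) = 0) ->
    0 < \sum_(j < L | (k <= j)%N) F u 0 (s j).

End Nonlinearity.

(* F is a total function, but only its values on the orthant matter, since the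
   solutions below have positive components where F is applied to them. *)
Section System.
Variables (R : realType) (n L : nat).
Implicit Types (F : 'rV[R]_L -> 'rV[R]_L) (u : 'rV[R]_n -> 'rV[R]_L).

Definition coord_fun u (i : 'I_L) : 'rV[R]_n -> R := fun x => u x 0 i.

Definition positive_solution_on (A : set 'rV[R]_n) F u : Prop :=
  [/\ forall i, C2_on A (coord_fun u i),
      forall x, A x -> forall i, - laplacian (coord_fun u i) x = F (u x) 0 i
    & forall x, A x -> all_pos (u x)].

Definition entire_solution F u : Prop := positive_solution_on setT F u.

Definition dirichlet_solution F (r : R) u : Prop :=
  [/\ positive_solution_on (eball r) F u,
      forall i, {within closure (eball r), continuous (coord_fun u i)}
    & forall x, boundary (eball r) x -> forall i, u x 0 i = 0].

Definition radial_on (A : set 'rV[R]_n) u (v : R -> 'rV[R]_L) : Prop :=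
  forall x, A x -> u x = v (enorm x).

End System.

(* Main.v *)
(* Shooting without uniqueness.  Initial values range over the simplex
   {alpha >= 0, sum alpha = a}; when no component of the solution of the radial
   ODE starting at alpha vanishes, it is an entire solution, and otherwise alpha
   is labelled by a component which vanishes at the first touching time.  A
   Knaster-Kuratowski-Mazurkiewicz argument gives alpha which is a limit, for
   each j with alpha_j > 0, of points labelled j.  If the solution from alpha
   first touches the boundary of the orthant at r0 in a point other than 0,
   non-degeneracy makes some component change sign at r0, so nearby solutions
   touch just after r0, while some other component j stays positive: this
   contradicts the label j.  If it touches at 0, it solves the Dirichlet problem.
   So it never touches, and its limit is a zero of F, which has to be 0.

   Labels are attached to Euler approximations, which depend continuously on
   alpha; the step is then sent to 0 along an ultrafilter, so that neither
   uniqueness nor continuous dependence is needed for the ODE itself. *)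
Require Import Defs.
From HB Require Import structures.
From mathcomp Require Import all_boot.
From mathcomp Require Import zify.

Set Implicit Arguments.
Unset Strict Implicit.
Unset Printing Implicit Defensive.

(** * A labelling lemma of Knaster-Kuratowski-Mazurkiewicz type *)

(** The mass [a] is a free parameter. Components only decrease, so a trajectory that stays positive
    keeps a component sum of at most [a]; for small [a] it lies where [F] has no positive zero, and
    this is what forces decay. A label is used only through one property: whenever any component is
    nonpositive, the labelled one is too. It is therefore enough to look at a single radius just
    after touching, where one component is strictly negative and another strictly positive: these
    signs survive both the discretization and the move from the limit point to a nearby labelled
    point. *)

Section Dominance.
Variables (I V : finType) (rho : I -> V -> nat).
Hypothesis rho_inj : forall i, injective (rho i).
Implicit Types (T : {set V}) (S : {set I}).

(* Dominance replaces a triangulation (Scarf; Petri and Voorneveld,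
   No bullying: a playful proof of Brouwer's fixed-point theorem). *)
Definition dominant T S :=
  [forall v, [exists i in S, [forall t in T, rho i v <= rho i t]]].

Lemma dominantP T S :
  reflect (forall v, exists2 i, i \in S & forall t, t \in T -> rho i v <= rho i t)
          (dominant T S).
Proof.
apply: (iffP forallP) => [D v|D v].
  have /exists_inP[i iS /forall_inP H] := D v; by exists i.
have [i iS H] := D v; apply/exists_inP; exists i => //; exact/forall_inP.
Qed.

Lemma dominantS T T' S S' :
  T' \subset T -> S \subset S' -> dominant T S -> dominant T' S'.
Proof.
move=> sT sS /dominantP D; apply/dominantP => v; have [i iS H] := D v.
exists i; first exact: (subsetP sS).
by move=> t tT; apply: H; apply: (subsetP sT).
Qed.

(** Dominance tested at a point [t] of [T] itself says that [t] is the [rho i]-minimum of [T] for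
    some [i] in [S], so these minima exhaust [T]. *)
Lemma argmin_dominant T S (m : I -> V) : dominant T S ->
    (forall i, m i \in T) -> (forall i t, t \in T -> rho i (m i) <= rho i t) ->
  m @: S = T.
Proof.
move=> /dominantP D mT mle; apply/setP => t; apply/imsetP/idP.
  by case=> i iS ->.
move=> tT; have [i iS H] := D t; exists i => //.
by apply/(@rho_inj i)/eqP; rewrite eqn_leq H ?mT // mle.
Qed.

Lemma argmin_ex T : T != set0 ->
  exists m : I -> V, (forall i, m i \in T) /\
    (forall i t, t \in T -> rho i (m i) <= rho i t).
Proof.
case/set0Pn => t0 t0T.
exists (fun i => [arg min_(t < t0 in T) rho i t]).
by split=> i; case: arg_minnP.
Qed.

(* A room is a dominant pair with #|T| = #|S|, so a dominant pair with
   #|S| = #|T|.+1 is a wall; it belongs to exactly two rooms, one for each of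
   the two indices whose removal keeps every element of T an i-minimum. *)
Lemma wall_two_rooms T S : T != set0 -> dominant T S -> #|S| = #|T|.+1 ->
  #|[set v | (v \notin T) && dominant (v |: T) S]|
    + #|[set l in S | dominant T (S :\ l)]| = 2.
Proof.
move=> T0 D cST.
have [m [mT mle]] := argmin_ex T0.
have mS := argmin_dominant D mT mle.
have mE i t : t \in T -> rho i t <= rho i (m i) -> t = m i.
  by move=> tT h; apply: (@rho_inj i); apply/eqP; rewrite eqn_leq h mle.
have [i iS [j jS [ij mij]]] :
    exists2 i, i \in S & exists2 j, j \in S & i != j /\ m i = m j.
  have : ~~ [forall i in S, forall j in S, (m i == m j) ==> (i == j)].
    apply/negP => /forall_inP H.
    have : #|m @: S| = #|S|.
      apply: card_in_imset => x y xS yS /eqP e.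
      by have /forall_inP/(_ y yS)/implyP/(_ e)/eqP := H x xS.
    by rewrite mS cST; lia.
  case/forall_inPn => i iS /forall_inPn[j jS]; rewrite negb_imply => /andP[/eqP e ne].
  by exists i => //; exists j.
have mSi : m @: (S :\ i) = T.
  rewrite -mS; apply/setP => t; apply/imsetP/imsetP => -[s].
    by move=> /setD1P[_ sS] ->; exists s.
  move=> sS ->; have [->|si] := eqVneq s i.
    by exists j => //; rewrite !inE eq_sym ij jS.
  by exists s => //; rewrite !inE si.
have minj : {in S :\ i &, injective m}.
  by apply/imset_injP/eqP; rewrite mSi; have := cardsD1 i S; rewrite iS; lia.
have mSj : m @: (S :\ j) = T.
  rewrite -mS; apply/setP => t; apply/imsetP/imsetP => -[s].
    by move=> /setD1P[_ sS] ->; exists s.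
  move=> sS ->; have [->|si] := eqVneq s j.
    by exists i => //; rewrite !inE ij iS.
  by exists s => //; rewrite !inE si.
have free l : l \in S -> m @: (S :\ l) = T -> l \in [set i; j].
  move=> lS ml; rewrite !inE; apply: contraT; rewrite negb_or => /andP[li lj].
  have : m l \in m @: (S :\ l) by rewrite ml.
  case/imsetP => p /setD1P[pl pS] e.
  have [pi|pi] := eqVneq p i.
    have := minj j l; rewrite !inE eq_sym ij jS li lS -mij e pi => /(_ isT isT erefl) jl.
    by rewrite jl eqxx in lj.
  have := minj p l; rewrite !inE pi pS li lS e => /(_ isT isT erefl) pE.
  by rewrite pE eqxx in pl.
pose W l := [set v | [forall s in S :\ l, rho s (m s) < rho s v]].
have WP l v : reflect (forall s, s \in S -> s != l -> rho s (m s) < rho s v) (v \in W l).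
  rewrite inE; apply: (iffP forall_inP) => [H s sS sl|H s /setD1P[sl sS]].
    by apply: H; rewrite !inE sl.
  exact: H.
have WD l v : v \in W l -> forall t, t \in T -> rho l v <= rho l t.
  move=> /WP vW t tT.
  have [s sS H] := (dominantP _ _ D) v.
  have [sl|sl] := eqVneq s l; first by rewrite -sl; exact: H.
  by have := vW s sS sl; rewrite ltnNge (H _ (mT s)).
have WT l v : l \in S -> m @: (S :\ l) = T -> v \in W l -> v \notin T.
  move=> lS ml /WP vW; apply/negP; rewrite -ml => /imsetP[s /setD1P[sl sS] e].
  by have := vW s sS sl; rewrite e ltnn.
pose top l := odflt (m i) [pick v in W l | [forall x in W l, rho l x <= rho l v]].
have topP l : W l != set0 -> top l \in W l /\ forall x, x \in W l -> rho l x <= rho l (top l).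
  case/set0Pn => w wW; rewrite /top; case: pickP => /= [v /andP[vW /forall_inP]//|H].
  have := H [arg max_(v > w in W l) rho l v].
  case: arg_maxnP => // v vW vm /negP[]; rewrite vW; exact/forall_inP.
have WE l : l \in S -> (W l == set0) = dominant T (S :\ l).
  move=> lS; apply/eqP/dominantP => [W0 v|D' ].
    have : v \notin W l by rewrite W0 inE.
    rewrite inE => /forall_inPn[s sS]; rewrite -leqNgt => h; exists s => // t tT.
    exact: leq_trans (mle _ _ tT).
  apply/setP => v; rewrite [RHS]inE; apply/negP => /WP vW.
  have [s /setD1P[sl sS] H] := D' v.
  by have := vW s sS sl; rewrite ltnNge (H _ (mT s)).
set E := [set l in [set i; j] | W l == set0].
have ijS l : l \in [set i; j] -> l \in S by rewrite !inE => /orP[]/eqP->.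
have mij' l : l \in [set i; j] -> m @: (S :\ l) = T by rewrite !inE => /orP[]/eqP->.
have -> : [set l in S | dominant T (S :\ l)] = E.
  apply/setP => l; rewrite [LHS]in_set [RHS]in_set; apply/andP/andP => -[lS].
    move=> D'; split; last by rewrite WE.
    apply: free => //; exact: argmin_dominant D' mT mle.
  by rewrite WE ?ijS // => ->; rewrite ijS.
have -> : [set v | (v \notin T) && dominant (v |: T) S] = top @: ([set i; j] :\: E).
  apply/setP => v; rewrite inE; apply/andP/imsetP.
    case=> vT D'.
    have vT0 : v |: T != set0 by apply/set0Pn; exists v; rewrite !inE eqxx.
    have [m' [m'T m'le]] := argmin_ex vT0.
    have m'S := argmin_dominant D' m'T m'le.
    have m'inj : {in S &, injective m'}.
      by apply/imset_injP/eqP; rewrite m'S cardsU1 vT cST.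
    have : v \in m' @: S by rewrite m'S !inE eqxx.
    case/imsetP => l lS vE.
    have m'm s : s \in S -> s != l -> m' s = m s /\ rho s (m s) < rho s v.
      move=> sS sl.
      have m'sv : m' s != v.
        by apply: contra sl => /eqP; rewrite vE => /m'inj -> //.
      have m'sT : m' s \in T by have := m'T s; rewrite !inE (negPf m'sv).
      have e : m' s = m s.
        by apply: mE => //; apply: m'le; rewrite inE mT orbT.
      split=> //; rewrite -e ltn_neqAle m'le ?inE ?eqxx // andbT.
      by apply: contra m'sv => /eqP/rho_inj ->.
    have ml : m @: (S :\ l) = T.
      apply/setP => t; apply/imsetP/idP => [[s _ ->]//|tT].
      have : t \in m' @: S by rewrite m'S !inE tT orbT.
      case/imsetP => s sS tE; have sl : s != l.
        by apply: contraNneq vT => sl; rewrite vE -sl -tE.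
      by exists s; rewrite ?inE ?sl // tE; case: (m'm s sS sl).
    have vW : v \in W l by apply/WP => s sS sl; case: (m'm s sS sl).
    have W0 : W l != set0 by apply/set0Pn; exists v.
    exists l.
      rewrite inE free // andbT inE free //=.
    have [tW tM] := topP l W0.
    apply: (@rho_inj l); apply/eqP; rewrite eqn_leq tM //=.
    have [s sS H] := (dominantP _ _ D') (top l).
    have [sl|sl] := eqVneq s l; first by move: H; rewrite sl; apply; rewrite !inE eqxx.
    have := H (m s); rewrite inE mT orbT => /(_ isT).
    by move=> h; move/WP: tW => /(_ s sS sl); rewrite ltnNge h.
  case=> l /setDP[lij lE] ->.
  have W0 : W l != set0 by apply: contra lE; rewrite inE lij.
  have [tW tM] := topP l W0; have lS := ijS _ lij.
  split; first by apply: WT tW => //; exact: mij'.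
  apply/dominantP => x.
  have [xW|] := boolP (x \in W l).
    exists l => // t; rewrite !inE => /orP[/eqP->|]; [exact: tM|exact: WD].
  rewrite inE => /forall_inPn[s /setD1P[sl sS]]; rewrite -leqNgt => h.
  exists s => // t; rewrite !inE => /orP[/eqP->|tT].
    by apply: (leq_trans h); apply: ltnW; move/WP: tW; exact.
  exact: leq_trans (mle _ _ tT).
(* A common value of [top i] and [top j] would lie above the minimum of [T] for every index of [S],
   against dominance. *)
rewrite card_in_imset; last first.
  move=> l l' /setDP[lij lE] /setDP[l'ij l'E] e; apply/eqP; apply: contraT => ll'.
  have W0 : W l != set0 by apply: contra lE; rewrite inE lij.
  have W0' : W l' != set0 by apply: contra l'E; rewrite inE l'ij.
  have [/WP tW _] := topP l W0.
  have [/WP tW' _] := topP l' W0'.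
  have [s sS H] := (dominantP _ _ D) (top l).
  have := H (m s) (mT s); rewrite leqNgt => /negP[].
  have [sl|sl] := eqVneq s l; last exact: tW.
  by rewrite e; apply: tW' => //; rewrite sl.
have sE : E \subset [set i; j] by apply/subsetP => l; rewrite inE => /andP[].
have := cardsD [set i; j] E; rewrite cards2 ij (setIidPr sE) => ->.
by have := subset_leq_card sE; rewrite cards2 ij => h; rewrite subnK.
Qed.

Section Colouring.
Variables (c : V -> I) (k : I) (v0 : V).

Definition door T S :=
  [&& dominant T S, #|c @: T| == #|T|, k \notin c @: T & S == k |: c @: T].

Definition room T S := dominant T S && (#|T| == #|S|).

Lemma door_card T S : door T S -> #|S| = #|T|.+1.
Proof. by case/and4P => _ /eqP <- kc /eqP ->; rewrite cardsU1 kc. Qed.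

(** A nonempty door is a wall and lies in two rooms. With [T] empty, the only room is reached by
    adding the highest point for [rho k], since dropping [k] would leave no index at all. *)
Lemma door_rooms T S : door T S ->
  odd (#|[set v | (v \notin T) && dominant (v |: T) S]|
       + #|[set l in S | dominant T (S :\ l)]|) = (T == set0).
Proof.
move=> dTS; have [T0|T0] := eqVneq T set0; last first.
  have D : dominant T S by case/and4P: dTS.
  by rewrite wall_two_rooms // (door_card dTS).
move: dTS; rewrite T0 => /and4P[_ _ _ /eqP]; rewrite imset0 setU0 => ->.
have -> : [set v | (v \notin set0) && dominant (v |: set0) [set k]] =
          [set [arg max_(v > v0) rho k v]].
  case: arg_maxnP => // w _ wM; apply/setP => v; rewrite !inE setU0 /=.
  apply/dominantP/eqP => [D|-> x].
    have [i] := D w; rewrite !inE => /eqP -> /(_ v); rewrite inE eqxx => /(_ isT) h.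
    by apply/(@rho_inj k)/eqP; rewrite eqn_leq h andbT; exact: wM.
  by exists k; rewrite ?inE // => t; rewrite inE => /eqP ->; exact: wM.
rewrite (_ : [set l in _ | _] = set0) ?cards1 ?cards0 ?eqxx //.
apply/setP => l; rewrite !inE; apply/andP => -[/eqP -> /dominantP/(_ v0)[i]].
by rewrite !inE; case: eqP.
Qed.

(** A balanced room has a single door: drop the point coloured [k] or, if [k] is not in [S], add [k]
    to [S]. In an unbalanced room every door has a partner. *)
Lemma room_doors T S : room T S ->
  odd (#|[set v in T | door (T :\ v) S]| + #|[set l | (l \notin S) && door T (l |: S)]|)
  = (c @: T == S).
Proof.
case/andP => D /eqP cTS.
have DT v : dominant (T :\ v) S by apply: dominantS D; rewrite ?subD1set.
have DS l : dominant T (l |: S) by apply: dominantS D; rewrite ?subsetUr.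
have [kS|kS] := boolP (k \in S); last first.
  rewrite (_ : [set v in T | _] = set0) ?cards0 ?add0n; last first.
    apply/setP => v; rewrite !inE; apply/andP => -[_ /and4P[_ _ _ /eqP e]].
    by move: kS; rewrite e !inE eqxx.
  have [e|ne] := eqVneq (c @: T) S.
    rewrite (_ : [set l | _] = [set k]) ?cards1 //.
    apply/setP => l; rewrite !inE /door DS /= e cTS eqxx kS /=.
    have [->|lk] := eqVneq l k; first by rewrite kS eqxx.
    apply/andP => -[lS /eqP/setP/(_ k)]; rewrite !inE eqxx (negPf kS) eq_sym.
    by rewrite (negPf lk).
  rewrite (_ : [set l | _] = set0) ?cards0 //.
  apply/setP => l; rewrite !inE; apply/andP => -[lS /and4P[_ _ kc /eqP e]].
  have lk : l = k.
    by move/setP/(_ k): e; rewrite !inE eqxx (negPf kS) orbF => /eqP.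
  move/eqP: ne; apply; apply/setP => x; move/setP/(_ x): e; rewrite lk !inE.
  by have [->|//] := eqVneq x k; rewrite (negPf kS) (negPf kc).
have doorT v : v \in T -> door (T :\ v) S = (c @: (T :\ v) == S :\ k).
  move=> vT; rewrite /door DT /=; apply/and3P/eqP => [[/eqP cc kc /eqP ->]|e].
    by rewrite setU1K.
  rewrite e setD1K // eqxx !inE eqxx /=; split=> //.
  by have := cardsD1 v T; have := cardsD1 k S; rewrite kS vT; lia.
set A := [set v in T | _]; set B := [set l | _].
have [e|ne] := eqVneq (c @: T) S.
  rewrite (_ : B = set0) ?cards0 ?addn0; last first.
    apply/setP => l; rewrite /B !inE; apply/andP => -[lS /and4P[_ _ kc _]].
    by rewrite e kS in kc.
  have cinj : {in T &, injective c} by apply/imset_injP/eqP; rewrite e cTS.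
  have := kS; rewrite -e => /imsetP[t tT kt].
  rewrite (_ : A = [set t]) ?cards1 //.
  apply/setP => v; rewrite ?/A ?/B in_set in_set1; apply/andP/eqP => [[vT]|->].
    rewrite doorT // => /eqP; rewrite kt.
    have [//|vt] := eqVneq v t; move/setP/(_ (c t)); rewrite !inE eqxx /=.
    by rewrite imset_f // !inE eq_sym vt.
  split=> //; rewrite doorT //; apply/eqP/setP => x; rewrite !inE -e.
  apply/imsetP/andP => [[w /setD1P[wt wT] ->]|[xk /imsetP[w wT xE]]].
    by rewrite imset_f // kt; split => //; apply: contra wt => /eqP/cinj ->.
  exists w => //; rewrite !inE wT andbT; apply: contra xk => /eqP wt.
  by rewrite xE wt kt.
(* Outside the balanced case the doors come in pairs. *)
have [[v vT ev]|nv] : (exists2 v, v \in T & c @: (T :\ v) = S :\ k) \/ A = set0.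
  have [->|/set0Pn[v]] := eqVneq A set0; [by right|move=> vA; left].
  by move: vA; rewrite /A inE => /andP[vT]; rewrite doorT // => /eqP; exists v.
- have cT : c @: T = c v |: S :\ k by rewrite -ev -imsetU1 setD1K.
  have cvk : c v != k.
    by apply: contra ne => /eqP e; rewrite cT e setD1K.
  have cinj : {in T :\ v &, injective c}.
    apply/imset_injP/eqP; rewrite ev.
    by have := cardsD1 v T; have := cardsD1 k S; rewrite kS vT; lia.
  (* If [c v] is in [S], some other point [w] has this colour and dropping [w] is the second door;
     otherwise the second door adds [c v] to [S]. *)
  have [cvS|cvS] := boolP (c v \in S).
    have -> : B = set0.
      apply/setP => l; rewrite /B !inE; apply/andP => -[lS /and4P[_ /eqP cc kc _]].
      have : c @: T = S :\ k by rewrite cT; apply/setUidPr; rewrite sub1set !inE cvk.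
      move=> e; rewrite e in cc; move: cc.
      by have := cardsD1 k S; rewrite kS; lia.
    have : c v \in c @: (T :\ v) by rewrite ev !inE cvk.
    case/imsetP => w /setD1P[wv wT] cw.
    have -> : A = [set v; w].
      apply/setP => x; rewrite /A in_set in_set2; apply/andP/orP => [[xT]|].
        rewrite doorT // => /eqP ex; have [xv|xv] := eqVneq x v; first by left.
        right; have : c x \in c @: (T :\ x).
          by rewrite ex -ev imset_f // !inE xv.
        case/imsetP => y /setD1P[yx yT] cxy; have [yv|yv] := eqVneq y v.
          rewrite yv cw in cxy; apply/eqP; apply: cinj => //; rewrite !inE ?xv ?wv //.
        case/eqP: yx; apply: cinj => //; rewrite !inE ?yv ?xv //.
      case=> /eqP ->; first by rewrite doorT // ev.
      split=> //; rewrite doorT // -ev; apply/eqP/setP => z.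
      apply/imsetP/imsetP => -[y /setD1P[yw yT] ->].
        have [->|yv] := eqVneq y v; first by exists w; rewrite ?inE ?wv.
        by exists y; rewrite ?inE ?yv.
      have [->|yv] := eqVneq y w; last by exists y; rewrite ?inE ?yv.
      by exists v; rewrite ?inE // eq_sym wv.
    by rewrite cards2 eq_sym wv cards0.
  have -> : A = [set v].
    apply/setP => x; rewrite ?/A ?/B in_set in_set1; apply/andP/eqP => [[xT]|->].
      rewrite doorT // => /eqP ex; have [//|xv] := eqVneq x v.
      have : c v \in c @: (T :\ x) by rewrite imset_f // !inE eq_sym xv.
      by rewrite ex !inE (negPf cvS) andbF.
    by rewrite doorT // ev.
  have -> : B = [set c v]; last by rewrite !cards1.
  have kcT : k \notin c @: T by rewrite cT !inE eqxx /= orbF eq_sym.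
  have kE : k |: c @: T = c v |: S by rewrite cT setUCA setD1K.
  apply/setP => l; rewrite ?/A ?/B in_set in_set1; apply/andP/eqP => [[lS /and4P[_ _ _ /eqP e]]|->].
    move: e; rewrite kE => /setP/(_ l); rewrite !inE eqxx (negPf lS) !orbF.
    by move=> /esym/eqP.
  split=> //; apply/and4P; split=> //; last by rewrite kE.
  by rewrite cT cardsU1 !inE (negPf cvS) andbF; have := cardsD1 k S; rewrite kS; lia.
(* A door that adds [l] has [l = c v] for some [v] in [T], and then dropping [v] would be a door as
   well. *)
- have -> : B = set0; last by rewrite nv !cards0.
  apply/setP => l; rewrite /B !inE; apply/andP => -[lS /and4P[_ /eqP cc kc /eqP e]].
  have lk : l != k by apply: contra lS => /eqP ->.
  have : l \in k |: c @: T by rewrite -e !inE eqxx.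
  rewrite !inE (negPf lk) /= => /imsetP[v vT lv].
  suff : v \in A by rewrite nv inE.
  have cinj : {in T &, injective c} by apply/imset_injP/eqP.
  rewrite /A inE vT doorT //=; apply/eqP/setP => x; rewrite !inE.
  have /setP/(_ x) := e; rewrite !inE => ex.
  apply/imsetP/andP => [[w /setD1P[wv wT] xE]|[xk xS]].
    have xc : x \in c @: T by rewrite xE imset_f.
    have xk : x != k by apply: contraNneq kc => <-.
    split=> //; move: ex; rewrite xc orbT; case: eqP => //= xl _.
    by case/eqP: wv; apply: cinj => //; rewrite -xE xl.
  move: ex; rewrite xS orbT (negPf xk) /= => /esym/imsetP[w wT xE].
  exists w => //; rewrite !inE wT andbT; apply: contraNneq lS => wv.
  by rewrite lv -wv -xE.
Qed.

End Colouring.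

(* Doors are the walls whose colours are exactly [S :\ k].  Only the wall
   [(set0, [set k])] belongs to a single room, and exactly the balanced rooms
   have an odd number of doors: counting incidences both ways, the number of
   balanced rooms is odd. *)
Lemma exists_balanced_room (c : V -> I) (k : I) (v0 : V) :
  exists T S, [/\ dominant T S, #|T| = #|S| & c @: T = S].
Proof.
pose inc T S T' S' := [exists v, [&& v \in T', T == T' :\ v & S == S']]
                   || [exists l, [&& l \notin S', S == l |: S' & T == T']].
suff : exists p : {set V} * {set I}, room p.1 p.2 && (c @: p.1 == p.2).
  by case=> -[T S] /= /andP[/andP[D /eqP cc] /eqP e]; exists T, S.
apply/existsP; apply: contraT; rewrite negb_exists => /forallP H.
have odd_sum (J : finType) (P : pred J) (F : J -> nat) :
    odd (\sum_(j | P j) F j) = \big[addb/false]_(j | P j) odd (F j).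
  exact: (big_morph odd oddD).
pose N := \sum_(p : {set V} * {set I} | door c k p.1 p.2)
            (#|[set v | (v \notin p.1) && dominant (v |: p.1) p.2]|
             + #|[set l in p.2 | dominant p.1 (p.2 :\ l)]|).
pose N' := \sum_(p : {set V} * {set I} | room p.1 p.2)
            (#|[set v in p.1 | door c k (p.1 :\ v) p.2]|
             + #|[set l | (l \notin p.2) && door c k p.1 (l |: p.2)]|).
(* An incidence joins a door to a room with one more point or one index less; each half of the sum
   is reindexed by moving that point or index to the other side. *)
have NE : N = N'.
  rewrite /N /N' !big_split /=; congr (_ + _).
    under eq_bigr do rewrite -sum1_card.
    under [RHS]eq_bigr do rewrite -sum1_card.
    rewrite !pair_big_dep /=.
    rewrite (reindex_onto (fun q : ({set V} * {set I}) * V => ((q.1.1 :\ q.2, q.1.2), q.2))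
              (fun q : ({set V} * {set I}) * V => ((q.2 |: q.1.1, q.1.2), q.2))) /=; last first.
      by case=> -[T S] v /=; rewrite inE => /andP[_ /andP[vT _]]; rewrite setU1K.
    apply: eq_bigl => -[[T S] v] /=; rewrite !inE eqxx /=.
    have [vT|vT] := boolP (v \in T).
      rewrite setD1K // eqxx andbT /room [in LHS]andbC; case: (boolP (door _ _ _ _)) => [/door_card|].
        by rewrite !andbT => ->; have := cardsD1 v T; rewrite vT => ->; rewrite eqxx andbT.
      by rewrite !andbF.
    rewrite andbF; apply/negP => /andP[_ /eqP[e]].
    by case/negP: vT; rewrite -e !inE eqxx.
  under eq_bigr do rewrite -sum1_card.
  under [RHS]eq_bigr do rewrite -sum1_card.
  rewrite !pair_big_dep /=.
  rewrite (reindex_onto (fun q : ({set V} * {set I}) * I => ((q.1.1, q.2 |: q.1.2), q.2))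
            (fun q : ({set V} * {set I}) * I => ((q.1.1, q.1.2 :\ q.2), q.2))) /=; last first.
    by case=> -[T S] l /=; rewrite inE => /andP[_ /andP[lS _]]; rewrite setD1K.
  apply: eq_bigl => -[[T S] l] /=; rewrite !inE eqxx /=.
  have [lS|lS] := boolP (l \in S).
    rewrite andbF; apply/negP => /andP[_ /eqP[e]].
    by move: lS; rewrite -e !inE eqxx.
  rewrite setU1K // eqxx andbT /room [in LHS]andbC; case: (boolP (door _ _ _ _)) => [/door_card|].
    by rewrite !andbT cardsU1 lS add1n => -[->]; rewrite eqxx andbT.
  by rewrite !andbF.
have : odd N = odd N' by rewrite NE.
rewrite /N /N' !odd_sum [in RHS]big1 => [|p rp]; last first.
  by rewrite room_doors //; move: (H p); rewrite rp /= => /negPf.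
have D0 : door c k set0 [set k].
  rewrite /door imset0 setU0 !cards0 !eqxx inE /= andbT.
  by apply/dominantP => v; exists k => [|t]; rewrite inE.
rewrite (bigD1 (set0, [set k])) //= (door_rooms v0 D0) eqxx.
rewrite big1 // => -[T S] /= /andP[dTS ne]; rewrite (door_rooms v0 dTS).
apply/negbTE; apply: contra ne => /eqP T0.
by move: dTS; rewrite T0 => /and4P[_ _ _ /eqP]; rewrite imset0 setU0 => ->.
Qed.

End Dominance.

(* No condition is put on the labels of boundary points; the price is that only
   the labels [l] with [g0 l] large are attained near [g0]. *)
Lemma grid_labels (L N : nat) (c : {ffun 'I_L -> 'I_N.+1} -> 'I_L) :
  (0 < L)%N ->
  exists2 g0 : {ffun 'I_L -> 'I_N.+1}, \sum_i (g0 i : nat) = N &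
    forall l, L < g0 l -> exists g : {ffun 'I_L -> 'I_N.+1},
      [/\ \sum_i (g i : nat) = N, c g = l &
          forall i, g i <= g0 i + L /\ g0 i <= g i + L].
Proof.
case: L c => // L c _.
have aux1 (x y d e f s : nat) : s <= L.+1 -> d <= e -> N < y + d + s ->
  x + e + f = N -> x <= y + L by lia.
have aux2 (x d e f s : nat) : s <= L.+1 -> d <= e -> N < d + s ->
  e + (x + f) = N -> x <= L by lia.
pose V := {g : {ffun 'I_L.+1 -> 'I_N.+1} | \sum_i (g i : nat) == N}.
have VS (f : {ffun 'I_L.+1 -> 'I_N.+1}) : \sum_i (f i : nat) == N -> exists v : V, val v = f.
  by move=> P; exists (exist _ f P).
have VN (v : V) : \sum_i (val v i : nat) = N by apply/eqP; case: v.
have [v0 _] : exists v : V, True.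
  have P : \sum_(i < L.+1) ([ffun i : 'I_L.+1 => if i == ord0 then @ord_max N else ord0] i : nat) == N.
    by rewrite (bigD1 ord0) //= ffunE eqxx big1 ?addn0 // => i /negPf; rewrite ffunE => ->.
  by have [v _] := VS _ P; exists v.
(* Order by the [i]-th coordinate; the enumeration rank breaks ties and makes [rho i] injective. *)
pose rho (i : 'I_L.+1) (v : V) := val v i * #|{: V}| + enum_rank v.
have rho_le i (v t : V) : rho i v <= rho i t -> val v i <= val t i.
  rewrite /rho leqNgt [val v i <= _]leqNgt; apply: contra => h.
  apply: leq_trans (_ : (val t i).+1 * #|{: V}| <= _).
    by rewrite mulSn addnC ltn_add2r ltn_ord.
  by apply: leq_trans (leq_addr _ _); rewrite leq_mul2r h orbT.
have rho_inj i : injective (rho i).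
  move=> v t e; have e' : val v i = val t i :> nat.
    by apply/eqP; rewrite eqn_leq !rho_le ?e.
  by move: e; rewrite /rho e' => /addnI/val_inj/enum_rank_inj.
have [T [S [D cTS cT]]] := exists_balanced_room rho_inj (fun v => c (val v)) ord0 v0.
have [i0 i0S] : exists i0, i0 \in S.
  by have [i iS _] := dominantP _ _ _ D v0; exists i.
have T0 : T != set0 by rewrite -card_gt0 cTS; apply/card_gt0P; exists i0.
have [t0 t0T] := set0Pn _ T0.
pose m (i : 'I_L.+1) : nat := val [arg min_(t < t0 in T) val t i] i.
have mle i (t : V) : t \in T -> m i <= val t i.
  by rewrite /m; case: arg_minnP => // w _ H /H.
have mge (v : V) : exists2 i, i \in S & val v i <= m i.
  have [i iS H] := dominantP _ _ _ D v; exists i => //.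
  by rewrite /m; case: arg_minnP => // w wT _; apply: rho_le; exact: H.
(* Otherwise the grid contains a point exceeding [m i] for all [i] in [S], with the surplus placed
   on [i0]; this contradicts dominance. *)
have mN : N < \sum_(i in S) (m i).+1.
  rewrite ltnNge; apply/negP => mN.
  pose h i := if i \in S then (m i).+1 + (if i == i0 then N - \sum_(i in S) (m i).+1 else 0) else 0.
  have hN : \sum_i h i = N.
    rewrite /h -big_mkcond big_split /= [X in _ + X](bigD1 i0) //= eqxx.
    rewrite [X in _ + (_ + X)]big1 ?addn0 ?subnKC // => i /andP[_ /negPf ->] //.
  have hE i : (inord (h i) : 'I_N.+1) = h i :> nat.
    have hi : h i <= \sum_i h i by rewrite (bigD1 i) //= leq_addr.
    by apply: inordK; rewrite ltnS -[leqRHS]hN.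
  have P : \sum_i ([ffun i => inord (h i) : 'I_N.+1] i : nat) == N.
    by under eq_bigr do rewrite ffunE hE; rewrite hN.
  have [v vE] := VS _ P; have [i iS] := mge v; rewrite vE ffunE hE /h iS; lia.
have cS : #|S| <= L.+1 by rewrite -[leqRHS]card_ord max_card.
have sumS (t : V) : \sum_(i in S) val t i + \sum_(i | i \notin S) val t i = N.
  by rewrite -[RHS](VN t) [RHS](bigID (mem S)).
have mN' : N < \sum_(i in S) m i + #|S|.
  by apply: (leq_trans mN); under eq_bigr do rewrite -addn1; rewrite big_split sum1_card.
(* The minima over [S] nearly exhaust the total [N], so on [T] each coordinate in [S] exceeds its
   minimum by less than the dimension, and the coordinates off [S] are themselves that small. An
   index with a large coordinate thus lies in [S], the set of colours of [T]. *)
have near (t : V) i : t \in T -> if i \in S then m i <= val t i <= m i + L else val t i <= L.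
  move=> tT; have := sumS t; case: ifPn => iS.
    rewrite mle // [X in X + _ = _](bigD1 i iS); apply: aux1 cS _ _.
      by apply: leq_sum => j _; exact: mle.
    by have := mN'; rewrite (bigD1 i iS).
  rewrite [X in _ + X = _](bigD1 i iS); apply: aux2 cS _ mN'.
  by apply: leq_sum => j _; exact: mle.
exists (val t0) => // l lL.
have lS : l \in S.
  have := near t0 l t0T; by case: ifP => // _ h; have := leq_trans lL h; rewrite ltnNge leqnSn.
move: lS; rewrite -cT => /imsetP[t tT ->].
exists (val t); split=> // i.
have := near t i tT; have := near t0 i t0T; case: ifP => _.
  move=> /andP[h1 h2] /andP[h3 h4].
  by split; [apply: leq_trans h4 _|apply: leq_trans h2 _]; exact: leq_add (leqnSn L).
by move=> h1 h2; split; [apply: leq_trans h2 _|apply: leq_trans h1 _]; apply: leq_trans (leqnSn L) (leq_addl _ _).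
Qed.

From mathcomp Require Import all_order all_algebra all_fingroup.
From mathcomp Require Import all_classical all_reals all_analysis.
From mathcomp Require Import ring lra.

Import Order.TTheory GRing.Theory Num.Theory.
Import numFieldNormedType.Exports.

Local Open Scope classical_set_scope.
Local Open Scope ring_scope.

(** * The Euler scheme *)

Section RowVectors.
Variables (R : realType) (L : nat).

Lemma row_norm_lt (x : 'rV[R]_L) (e : R) : 0 < e -> (forall i, `|x 0 i| < e) -> `|x| < e.
Proof.
move=> e0 H; rewrite /Num.Def.normr /= mx_normrE; apply: bigmax_lt => // -[i j] _ /=.
by rewrite (ord1 i).
Qed.

Lemma coord_norm_le (x : 'rV[R]_L) i : `|x 0 i| <= `|x|.
Proof. rewrite [leRHS]/Num.Def.normr /= mx_normrE; exact: (le_bigmax _ (fun ij => `|x ij.1 ij.2|) (0, i)). Qed.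

Lemma row_cvg (T : Type) (D : set_system T) {FD : Filter D} (f : T -> 'rV[R]_L) (l : 'rV[R]_L) :
  (forall i, f x 0 i @[x --> D] --> l 0 i) -> f x @[x --> D] --> l.
Proof.
move=> H; apply/cvgrPdist_lt => e e0.
have : \forall x \near D, forall i, `|l 0 i - f x 0 i| < e.
  by apply: filter_forall => i; move/cvgrPdist_lt: (H i); exact.
apply: filterS => x Hx; apply: row_norm_lt => // i.
by rewrite !mxE; exact: Hx.
Qed.

Lemma coord_cvg (T : Type) (D : set_system T) {FD : Filter D} (f : T -> 'rV[R]_L) (l : 'rV[R]_L) i :
  f x @[x --> D] --> l -> f x 0 i @[x --> D] --> l 0 i.
Proof.
move=> fl; apply: (@cvg_comp _ _ _ f (fun u : 'rV[R]_L => u 0 i) _ (nbhs l)) => //.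
exact: coord_continuous.
Qed.

(** Only [x] has to lie in [K]. The form valid for all small [d] lets finitely many Euler steps
    share one modulus. *)
Lemma compact_unif_continuous (K : set 'rV[R]_L) (f : 'rV[R]_L -> 'rV[R]_L) (e : R) :
  compact K -> continuous f -> 0 < e ->
  \forall d \near 0^'+, forall x y, K x -> `|x - y| < d -> `|f x - f y| < e.
Proof.
move=> /compact_near_coveringP cK fc e0.
have := cK _ 0^'+ (fun d x => forall y, `|x - y| < d -> `|f x - f y| < e) _.
move=> H; suff : \forall d \near 0^'+, K `<=` (fun x => forall y, `|x - y| < d -> `|f x - f y| < e).
  by apply: filterS => d Kd x y /Kd; exact.
apply: H => x Kx; have e20 : 0 < e / 2 by rewrite divr_gt0.
have /cvgrPdist_lt/(_ _ e20)/nbhs_ballP[d /= d0 dP] := fc x.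
have d20 : 0 < d / 2 by rewrite divr_gt0.
exists (ball x (d / 2), [set t | t < d / 2]).
  by split; [exact: nbhsx_ballx|exact: nbhs_right_lt].
move=> [x' t] /= []; rewrite -ball_normE /= => xx' td y x'y.
have dx' : `|f x - f x'| < e / 2.
  by apply: dP; rewrite -ball_normE /=; apply: lt_trans xx' _; lra.
have dy : `|f x - f y| < e / 2.
  apply: dP; rewrite -ball_normE /=.
  by have := ler_distD x' x y; lra.
by have := ler_distD (f x) (f x') (f y); rewrite (distrC (f x') (f x)); lra.
Qed.

End RowVectors.

Section Euler.
Variables (R : realType) (L m : nat) (G : 'rV[R]_L -> 'rV[R]_L).

(* Discretization of P' = r^m G(u), u' = - r^(-m) P on the grid of step h. *)
Fixpoint euler (h : R) (a : 'rV[R]_L) (j : nat) : 'rV[R]_L * 'rV[R]_L :=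
  if j is j'.+1 then
    let P := (euler h a j').2 + (h * (h *+ j') ^+ m) *: G (euler h a j').1 in
    ((euler h a j').1 - (h * (h *+ j) ^- m) *: P, P)
  else (a, 0).

Lemma eulerSP h a j i : (euler h a j.+1).2 0 i =
  (euler h a j).2 0 i + h * ((h *+ j) ^+ m * G (euler h a j).1 0 i).
Proof. by rewrite /= !mxE mulrA. Qed.

(** The weight is taken at the right end of the step, so [r^-m] is never evaluated at the origin. *)
Lemma eulerSu h a j i : (euler h a j.+1).1 0 i =
  (euler h a j).1 0 i - h * ((h *+ j.+1) ^- m * (euler h a j.+1).2 0 i).
Proof. by rewrite /= !mxE !mulrA. Qed.

Lemma euler_continuous h j : continuous G ->
  continuous (fun a => (euler h a j).1) /\ continuous (fun a => (euler h a j).2).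
Proof.
move=> Gc; elim: j => [|j [IHu IHP]].
  split; move=> x /=; first exact: cvg_id.
  exact: cst_continuous.
have cP : continuous (fun a => (euler h a j.+1).2).
  move=> x; apply: (@cvgD _ _ _ (nbhs x) _ (fun a => (euler h a j).2)
    (fun a => (h * (h *+ j) ^+ m) *: G (euler h a j).1) (euler h x j).2
    ((h * (h *+ j) ^+ m) *: G (euler h x j).1)); first exact: IHP.
  apply: (@cvgZl_tmp _ _ _ (nbhs x) _ _ (fun a => G (euler h a j).1)).
  by apply: (@continuous_comp _ _ _ (fun a => (euler h a j).1) G); [exact: IHu|exact: Gc].
split=> // x; apply: (@cvgB _ _ _ (nbhs x) _ (fun a => (euler h a j).1)
    (fun a => (h * (h *+ j.+1) ^- m) *: (euler h a j.+1).2) (euler h x j).1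
    ((h * (h *+ j.+1) ^- m) *: (euler h x j.+1).2)); first exact: IHu.
by apply: (@cvgZl_tmp _ _ _ (nbhs x) _ _ (fun a => (euler h a j.+1).2)); exact: cP.
Qed.

Section Bounds.
Variables (M h : R) (a : 'rV[R]_L).
Hypotheses (h0 : 0 < h) (G0 : forall u i, 0 <= G u 0 i) (GM : forall u i, G u 0 i <= M).

Let gridX_ge0 k j : 0 <= (h *+ j) ^+ k.
Proof. by rewrite exprn_ge0 // mulrn_wge0 // ltW. Qed.

Let M0 (i : 'I_L) : 0 <= M.
Proof. exact: le_trans (G0 0 i) (GM 0 i). Qed.

Lemma euler_P_ge0 j i : 0 <= (euler h a j).2 0 i.
Proof.
elim: j => [|j IH]; first by rewrite /= mxE.
by rewrite eulerSP addr_ge0 // mulr_ge0 ?mulr_ge0 // ltW.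
Qed.

(** The factor [1/(m+1)] is given up to make the induction immediate. What counts is the power
    [m.+1]: it compensates the weight [r^-m], so the slopes of [u] stay below [M * r] up to the
    origin. *)
Lemma euler_P_le j i : (euler h a j).2 0 i <= M * (h *+ j) ^+ m.+1.
Proof.
elim: j => [|j IH]; first by rewrite /= mxE mulr_ge0 ?(M0 i).
rewrite eulerSP; apply: (@le_trans _ _ (M * ((h *+ j) ^+ m * (h *+ j.+1)))).
  have : (h *+ j) ^+ m * G (euler h a j).1 0 i <= (h *+ j) ^+ m * M by rewrite ler_wpM2l.
  move=> /(ler_wpM2l (ltW h0)); move: IH; rewrite exprS mulrSr; lra.
apply: ler_wpM2l; first exact: (M0 i).
rewrite [leRHS]exprSr; apply: ler_wpM2r; first by rewrite mulrn_wge0 ?ltW.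
have hj k : 0 <= h *+ k by rewrite mulrn_wge0 ?ltW.
by apply: lerXn2r; rewrite ?nnegrE // mulrSr lerDl ltW.
Qed.

Lemma euler_P_step j i :
  0 <= (euler h a j.+1).2 0 i - (euler h a j).2 0 i <= h * ((h *+ j) ^+ m * M).
Proof.
rewrite eulerSP addrAC subrr add0r mulr_ge0 ?(ltW h0) ?mulr_ge0 //=.
by rewrite ler_wpM2l ?(ltW h0) // ler_wpM2l.
Qed.

Lemma euler_u_step j i :
  0 <= (euler h a j).1 0 i - (euler h a j.+1).1 0 i <= h * ((h *+ j.+1) * M).
Proof.
have -> : (euler h a j).1 0 i - (euler h a j.+1).1 0 i =
          h * ((h *+ j.+1) ^- m * (euler h a j.+1).2 0 i) by rewrite eulerSu; lra.
have x0 : 0 < h *+ j.+1 by rewrite mulrn_wgt0.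
rewrite mulr_ge0 ?(ltW h0) ?mulr_ge0 ?invr_ge0 ?euler_P_ge0 // andTb.
rewrite ler_wpM2l ?(ltW h0) // mulrC ler_pdivrMr ?exprn_gt0 //.
by apply: le_trans (euler_P_le _ _) _; rewrite exprS mulrCA mulrA.
Qed.

Lemma euler_u_nincr i : {homo (fun j => (euler h a j).1 0 i) : j k / (j <= k)%N >-> k <= j}.
Proof.
apply: homo_leq => [//|y x z yx zy|j]; first exact: le_trans zy yx.
by have /andP[] := euler_u_step j i; rewrite subr_ge0.
Qed.

(* Components are nonincreasing, so a component that vanishes at the first
   touching time is nonpositive at every time when some component is. *)
Lemma euler_label : (0 < L)%N -> exists j : 'I_L,
  forall k i, (euler h a k).1 0 i <= 0 -> (euler h a k).1 0 j <= 0.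
Proof.
move=> L0.
have [[k /existsP[i ki]]|H] := pselect (exists k, [exists i, (euler h a k).1 0 i <= 0]); last first.
  exists (Ordinal L0) => k i ki; exfalso; apply: H; exists k.
  by apply/existsP; exists i.
have ex : exists k, [exists i, (euler h a k).1 0 i <= 0] by exists k; apply/existsP; exists i.
case: (ex_minnP ex) => k0 /existsP[j jk] kmin; exists j => k' i' H.
apply: le_trans jk; apply: euler_u_nincr; apply: kmin; apply/existsP; by exists i'.
Qed.

End Bounds.

(** Continuity of finitely many Euler steps in the starting point turns the grid proximity of
    [grid_labels] into proximity of trajectories, for one fixed step size. *)
Lemma approx_point (M h s eta : R) (J : nat) : (0 < L)%N ->
  0 < h -> 0 < s -> 0 < eta -> continuous G ->
  (forall u i, 0 <= G u 0 i) -> (forall u i, G u 0 i <= M) ->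
  exists a : 'rV[R]_L, [/\ forall i, 0 <= a 0 i, \sum_i a 0 i = s &
    forall j, eta < a 0 j -> exists b : 'rV[R]_L,
      (forall k, (k <= J)%N -> `|(euler h a k).1 - (euler h b k).1| < eta) /\
      (forall k i, (euler h b k).1 0 i <= 0 -> (euler h b k).1 0 j <= 0)].
Proof.
move=> L0 h0 s0 eta0 Gc G0 GM.
have [d [d0 dP]] : exists d : R, 0 < d /\ forall k, (k <= J)%N -> forall x y : 'rV[R]_L,
    (forall i, `[0, s]%classic (x 0 i)) -> `|x - y| < d -> `|(euler h x k).1 - (euler h y k).1| < eta.
  have cK : compact [set x : 'rV[R]_L | forall i, `[0, s]%classic (x 0 i)].
    by apply: (@rV_compact R L (fun=> `[0, s]%classic)) => i; exact: segment_compact.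
  have : \forall d \near (0 : R)^'+, forall k, (k <= J)%N -> forall x y : 'rV[R]_L,
    (forall i, `[0, s]%classic (x 0 i)) -> `|x - y| < d -> `|(euler h x k).1 - (euler h y k).1| < eta.
    elim: J => [|J' IH].
      have := compact_unif_continuous cK (euler_continuous h 0 Gc).1 eta0.
      by apply: filterS => d H k; rewrite leqn0 => /eqP -> x y; exact: H.
    have := compact_unif_continuous cK (euler_continuous h J'.+1 Gc).1 eta0.
    apply: filterS2 IH => d IH H k; rewrite leq_eqVlt => /orP[/eqP -> x y|]; first exact: H.
    by rewrite ltnS; exact: IH.
  move=> H; near ((0 : R)^'+) => d; exists d; split; near: d => //.
  exact: nbhs_right_gt.
pose e := Num.min d eta; have e0 : 0 < e by rewrite lt_min d0.
(* [L] mesh widths are below [d], so that trajectories stay close, and below [eta], so that a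
   component larger than [eta] exceeds [L] grid units. *)
pose N := (Num.truncn (s * L%:R / e)).+1.
have Ne : s / N%:R * L%:R < e.
  have := truncnS_gt (s * L%:R / e); rewrite -/N ltr_pdivrMr // => H.
  by rewrite mulrAC ltr_pdivrMr ?ltr0n // (mulrC e).
have [Nd Neta] : s / N%:R * L%:R < d /\ s / N%:R * L%:R < eta.
  by move: Ne; rewrite /e lt_min => /andP[].
have sN0 : 0 < s / N%:R by rewrite divr_gt0 // ltr0n.
pose pt (g : {ffun 'I_L -> 'I_N.+1}) : 'rV[R]_L := \row_i (s / N%:R * (g i)%:R).
have /choice[c cP] : forall g, exists j : 'I_L,
    forall k i, (euler h (pt g) k).1 0 i <= 0 -> (euler h (pt g) k).1 0 j <= 0.
  by move=> g; exact: euler_label.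
have [g0 g0N gP] := grid_labels c L0.
have pt_sum (g : {ffun 'I_L -> 'I_N.+1}) : (\sum_i (g i : nat))%N = N -> \sum_i pt g 0 i = s.
  move=> gN; under eq_bigr do rewrite mxE.
  by rewrite -mulr_sumr -natr_sum gN mulfVK // pnatr_eq0.
have pt_ge0 g i : 0 <= pt g 0 i by rewrite mxE mulr_ge0 // ltW.
exists (pt g0); split=> [i|//|j]; [exact: pt_ge0|exact: pt_sum|].
rewrite mxE => etaj; have : (L < g0 j)%N.
  rewrite -(ltr_nat R) -(ltr_pM2l sN0); exact: lt_trans Neta etaj.
case/gP => g [gN cg gg0]; exists (pt g); split; last by rewrite -cg; exact: cP.
move=> k kJ; apply: dP => // [i|].
  rewrite /= in_itv /= pt_ge0 /= -(pt_sum _ g0N) (bigD1 i) //= lerDl.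
  by apply: sumr_ge0 => l _; exact: pt_ge0.
apply: row_norm_lt => // i; apply: le_lt_trans Nd.
rewrite !mxE -mulrBr normrM gtr0_norm // ler_wpM2l ?(ltW sN0) //.
have [h1 h2] := gg0 i; rewrite ler_distl lerBlDr -!natrD !ler_nat.
by rewrite h1 h2.
Unshelve. all: by end_near.
Qed.

End Euler.

(** * Limits along an ultrafilter *)

Lemma is_derive_near (R : realType) (V : normedModType R) (f : V -> R) (a v : V) (c : R) :
  (forall e : R, 0 < e -> \forall h \near (0 : R),
     `|f (h *: v + a) - f a - h * c| <= e * `|h|) -> is_derive a v f c.
Proof.
move=> H.
have D : h^-1 *: (f (h *: v + a) - f a) @[h --> (0 : R)^'] --> c.
  apply/cvgrPdist_le => e e0; have /= := H e e0.
  move=> Hn; near=> h; have h0 : h != 0 by near: h; exact: nbhs_dnbhs_neq.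
  have : `|f (h *: v + a) - f a - h * c| <= e * `|h| by near: h; exact: cvg_within.
  rewrite -(@ler_pM2l _ `|h|^-1) ?invr_gt0 ?normr_gt0 // mulrCA mulVf ?normr_eq0 // mulr1.
  rewrite -normfV -normrM mulrBr mulKf // distrC; exact: le_trans.
split; first by apply/cvg_ex; exists c.
exact: cvg_lim D.
Unshelve. all: by end_near.
Qed.

(** This replaces the extraction of subsequences: one ultrafilter gives limits at all radii and for
    all components simultaneously. *)
Lemma ultra_bounded_cvg (R : realType) (T : Type) (U : set_system T) (f : T -> R) (b : R) :
  UltraFilter U -> (forall k, `|f k| <= b) -> exists l : R, f x @[x --> U] --> l.
Proof.
move=> UU fb; have := @segment_compact R (- b) b.
move=> /(_ (f @ U) _)[|l [_ cl]].
  by apply: nearW => k; rewrite /= in_itv /= -ler_norml fb.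
exists l => W Wl; have [//|WC] := in_ultra_setVsetC (f @^-1` W) UU.
by have [p []] := cl (~` W) W WC Wl.
Qed.

(** A discrete mean value inequality: slopes within [C] of [c] at each step stay so on average. *)
Lemma steps_le (R : realType) (y : nat -> R) (h c C : R) (j l : nat) : (j <= l)%N ->
  (forall p, (j <= p < l)%N -> `|y p.+1 - y p - h * c| <= h * C) ->
  `|y l - y j - (h *+ l - h *+ j) * c| <= (h *+ l - h *+ j) * C.
Proof.
elim: l => [|l IH].
  by rewrite leqn0 => /eqP -> _; rewrite !subrr !mul0r subrr normr0.
rewrite leq_eqVlt => /orP[/eqP ->|jl] H; first by rewrite !subrr !mul0r subrr normr0.
rewrite ltnS in jl.
have {}IH : `|y l - y j - (h *+ l - h *+ j) * c| <= (h *+ l - h *+ j) * C.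
  by apply: IH => // p /andP[jp pl]; apply: H; rewrite jp ltnS ltnW.
have Hl : (j <= l < l.+1)%N by rewrite jl /=.
have {}H := H l Hl.
rewrite mulrSr.
have -> : y l.+1 - y j - (h *+ l + h - h *+ j) * c =
  (y l - y j - (h *+ l - h *+ j) * c) + (y l.+1 - y l - h * c) by ring.
have -> : (h *+ l + h - h *+ j) * C = (h *+ l - h *+ j) * C + h * C by ring.
exact: le_trans (ler_normD _ _) (lerD IH H).
Qed.

Section GridLimit.
Variables (R : realType) (U : set_system nat).
Hypotheses (UU : UltraFilter U) (Uoo : \oo `<=` U).

Definition gstep (k : nat) : R := k.+1%:R^-1.
(** Index of the last grid point not beyond [|r|]; the absolute value produces the even
    extension. *)
Definition gidx (k : nat) (r : R) : nat := Num.truncn (`|r| * k.+1%:R).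

Lemma gstep_gt0 k : 0 < gstep k. Proof. by rewrite invr_gt0 ltr0n. Qed.

Lemma gstep_small (e : R) : 0 < e -> \forall k \near U, gstep k < e.
Proof.
move=> e0; apply: Uoo; exists (Num.truncn e^-1) => // k /= ek.
rewrite /gstep invf_plt ?posrE ?ltr0n //.
by apply: lt_le_trans (truncnS_gt _) _; rewrite ler_nat ltnS.
Qed.

Lemma gidx_itv k r : gstep k *+ gidx k r <= `|r| < gstep k *+ gidx k r + gstep k.
Proof.
have k0 : 0 < k.+1%:R :> R by rewrite ltr0n.
have := truncn_itv (mulr_ge0 (normr_ge0 r) (ltW k0)); rewrite -/(gidx k r).
rewrite -mulrSr -[gstep k *+ _]mulr_natl -[gstep k *+ _.+1]mulr_natl /gstep.
by rewrite ler_pdivrMr // ltr_pdivlMr.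
Qed.

Lemma gidx_cvg r : gstep k *+ gidx k r @[k --> U] --> `|r|.
Proof.
apply/cvgrPdist_lt => e e0; apply: filterS (gstep_small e0) => k ke.
have /andP[h1 h2] := gidx_itv k r; rewrite ger0_norm ?subr_ge0 //; lra.
Qed.

Lemma gidx_homo k r r' : `|r| <= `|r'| -> (gidx k r <= gidx k r')%N.
Proof. by move=> rr'; apply: le_truncn; rewrite ler_wpM2r. Qed.

(* The filter on pairs (step index [k], grid index [j]) along which [k] follows
   [U] and the grid point tends to [t]. *)
Definition grid_at (t : R) : set_system (nat * nat) :=
  [set B | exists2 d : R, 0 < d &
     \forall k \near U, forall j, `|gstep k *+ j - t| < d -> B (k, j)].

Global Instance grid_at_filter t : Filter (grid_at t).
Proof.
split=> [|A B [d d0 dA] [e e0 eB]|A B AB [d d0 dA]].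
- by exists 1 => //; apply: nearW.
- exists (Num.min d e); first by rewrite lt_min d0.
  apply: filterS2 dA eB => k kA kB j; rewrite lt_min => /andP[jd je].
  by split; [exact: kA|exact: kB].
- by exists d => //; apply: filterS dA => k kA j /kA/AB.
Qed.

Lemma grid_at_pos_cvg t : gstep p.1 *+ p.2 @[p --> grid_at t] --> t.
Proof.
by apply/cvgrPdist_lt => e e0; exists e => //; apply: nearW => k j /=; rewrite distrC.
Qed.

Lemma grid_at_step_cvg t : gstep p.1 @[p --> grid_at t] --> (0 : R).
Proof.
apply/cvgrPdist_lt => e e0; exists 1 => //.
apply: filterS (gstep_small e0) => k ke j _ /=.
by rewrite sub0r normrN gtr0_norm ?gstep_gt0.
Qed.

Lemma grid_at_next_cvg t : gstep p.1 *+ p.2.+1 @[p --> grid_at t] --> t.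
Proof.
rewrite -[X in _ --> X]addr0; under eq_fun do rewrite mulrSr.
apply: cvgD; [exact: grid_at_pos_cvg|exact: grid_at_step_cvg].
Qed.

Lemma grid_at_shift t (y : nat -> nat -> R) (c : R) :
  y p.1 p.2 @[p --> grid_at t] --> c -> y p.1 p.2.+1 @[p --> grid_at t] --> c.
Proof.
move=> yc B /yc[d d0 dB]; have d20 : 0 < d / 2 by rewrite divr_gt0.
exists (d / 2) => //; apply: filterS2 dB (gstep_small d20) => k kB kd j jd /=.
apply: kB; rewrite mulrSr.
have -> : gstep k *+ j + gstep k - t = (gstep k *+ j - t) + gstep k by ring.
apply: le_lt_trans (ler_normD _ _) _; rewrite (gtr0_norm (gstep_gt0 k)); lra.
Qed.

Section Sequences.
Variables (y : nat -> nat -> R) (Y : R -> R).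
Hypothesis yY : forall r, y k (gidx k r) @[k --> U] --> Y r.

Lemma limit_increment (j r c C : R) :
  `|j| <= `|r| ->
  (\forall k \near U,
     `|y k (gidx k r) - y k (gidx k j) - (gstep k *+ gidx k r - gstep k *+ gidx k j) * c|
       <= (gstep k *+ gidx k r - gstep k *+ gidx k j) * C) ->
  `|Y r - Y j - (`|r| - `|j|) * c| <= (`|r| - `|j|) * C.
Proof.
move=> jr H.
have dc : (gstep k *+ gidx k r - gstep k *+ gidx k j) @[k --> U] --> (`|r| - `|j|).
  by apply: cvgB; exact: gidx_cvg.
have PU : ProperFilter U by exact: ultra_proper.
refine (@ler_cvg_to nat U PU R _ _ _ _ _ _ H).
  by apply: cvg_norm; apply: cvgB; [apply: cvgB; exact: yY|exact: cvgMr_tmp].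
exact: cvgMr_tmp.
Qed.

Variable (C : R -> R).
Hypothesis C0 : forall T, 0 <= T -> 0 <= C T.
Hypothesis ylip : forall T k l, gstep k *+ l.+1 <= T -> `|y k l.+1 - y k l| <= gstep k * C T.

Lemma grid_lip T k j l : (j <= l)%N -> gstep k *+ l <= T ->
  `|y k l - y k j| <= (gstep k *+ l - gstep k *+ j) * C T.
Proof.
move=> jl lT; have := @steps_le R (y k) (gstep k) 0 (C T) j l jl.
rewrite !mulr0 subr0; apply=> p /andP[jp pl]; rewrite subr0; apply: ylip.
by apply: le_trans lT; apply: ler_wpMn2l => //; exact/ltW/gstep_gt0.
Qed.

Lemma limit_lip T r r' : `|r| <= T -> `|r'| <= T ->
  `|Y r - Y r'| <= `| `|r| - `|r'| | * C T.
Proof.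
wlog rr' : r r' / `|r'| <= `|r|.
  move=> H rT r'T; have [rr'|/ltW rr'] := leP `|r'| `|r|; first exact: H.
  by rewrite distrC (distrC `|r|); exact: H.
move=> rT r'T; rewrite (ger0_norm (_ : 0 <= `|r| - `|r'|)) ?subr_ge0 //.
have := @limit_increment r' r 0 (C T) rr'.
rewrite !mulr0 subr0; apply; apply: nearW => k; rewrite mulr0 subr0.
apply: grid_lip; first exact: gidx_homo.
by have /andP[h _] := gidx_itv k r; exact: le_trans rT.
Qed.

Lemma limit_continuous : continuous Y.
Proof.
move=> r; apply/cvgrPdist_lt => e e0.
pose T := `|r| + 1; have CT : 0 <= C T by apply: C0; rewrite addr_ge0.
have CT1 : 0 < C T + 1 by rewrite ltr_wpDl.
have d0 : 0 < Num.min 1 (e / (C T + 1)) by rewrite lt_min ltr01 divr_gt0.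
apply: filterS (nbhsx_ballx r _ d0) => t; rewrite -ball_normE /= lt_min => /andP[t1 te].
have h1 : `| `|r| - `|t| | <= `|r - t| by exact: ler_dist_dist.
have tT : `|t| <= T.
  by have := ler_normB r (r - t); rewrite (_ : r - (r - t) = t); [rewrite /T; lra|ring].
apply: le_lt_trans (@limit_lip T r t _ tT) _; first by rewrite /T lerDl.
move: te; rewrite ltr_pdivlMr //; apply: le_lt_trans.
by apply: ler_pM => //; rewrite lerDl.
Qed.

(** The common Lipschitz bound upgrades convergence at the indices [gidx k r] to convergence at any
    grid points tending to [t]; the Euler slopes are evaluated at such points. *)
Lemma limit_grid_cvg t : 0 <= t -> y p.1 p.2 @[p --> grid_at t] --> Y t.
Proof.
move=> t0; apply/cvgrPdist_lt => e e0.
pose T := t + 1; have CT : 0 <= C T by apply: C0; rewrite addr_ge0.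
have CT1 : 0 < C T + 1 by rewrite ltr_wpDl.
(* The grid points of [j] and of [gidx k t] are both within [d] of [t], so the values differ by at
   most [2 * d * C T], hence by at most [e / 2]. Adding 1 avoids a zero denominator. *)
pose d := Num.min 1 (e / 4 / (C T + 1)).
have d0 : 0 < d by rewrite lt_min ltr01 !divr_gt0.
have dC : d * C T <= e / 4.
  have : d <= e / 4 / (C T + 1) by rewrite ge_min lexx orbT.
  rewrite ler_pdivlMr // mulrDr mulr1; have := ltW d0; lra.
exists d => //.
have e20 : 0 < e / 2 by rewrite divr_gt0.
have /cvgrPdist_lt/(_ _ e20) yt := @yY t.
apply: filterS2 yt (gstep_small d0) => k yk kd j jd /=.
have [d1 gt_itv] : d <= 1 /\ gstep k *+ gidx k t <= t < gstep k *+ gidx k t + gstep k.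
  by split; [rewrite ge_min lexx|have := gidx_itv k t; rewrite (ger0_norm t0)].
have /andP[g1 g2] := gt_itv.
move: jd; rewrite ltr_distl => /andP[j1 j2].
suff : `|y k (gidx k t) - y k j| <= e / 2.
  by have := ler_distD (y k (gidx k t)) (Y t) (y k j); lra.
have dd : d * C T + d * C T <= e / 2 by lra.
have gk0 := gstep_gt0 k.
have [jl|lj] := leqP j (gidx k t).
  apply: le_trans (@grid_lip T _ _ _ jl _) _; first by rewrite /T; lra.
  apply: le_trans dd; rewrite -mulrDl ler_wpM2r //; lra.
rewrite distrC; apply: le_trans (@grid_lip T _ _ _ (ltnW lj) _) _; first by rewrite /T; lra.
apply: le_trans dd; rewrite -mulrDl ler_wpM2r //; lra.
Qed.

End Sequences.

(** Discrete slopes near [t] are within [e] of [c]; by [steps_le] so are the mean slopes over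
    intervals near [t], and this inequality passes to the limit. *)
Lemma limit_is_derive (y g : nat -> nat -> R) (Y : R -> R) (t c : R) :
  (forall r, y k (gidx k r) @[k --> U] --> Y r) ->
  (forall k j, y k j.+1 = y k j + gstep k * g k j) -> 0 < t ->
  g p.1 p.2 @[p --> grid_at t] --> c -> is_derive t 1 Y c.
Proof.
move=> yY yg t0 /cvgrPdist_le gc; apply: is_derive_near => e e0.
have [d d0 dP] := gc e e0; have d20 : 0 < d / 2 by rewrite divr_gt0.
have key r r' : 0 < r -> r <= r' -> `|r - t| < d / 2 -> `|r' - t| < d / 2 ->
    `|Y r' - Y r - (r' - r) * c| <= (r' - r) * e.
  move=> r0 rr'; rewrite !ltr_distl => /andP[r1 r2] /andP[r3 r4].
  have r'0 : 0 < r' by exact: lt_le_trans rr'.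
  have := @limit_increment y Y yY r r' c e; rewrite (gtr0_norm r0) (gtr0_norm r'0).
  apply=> //; apply: filterS2 dP (gstep_small d20) => k kP kd.
  apply: steps_le => [|p /andP[p1 p2]]; first by apply: gidx_homo; rewrite !gtr0_norm.
  have -> : y k p.+1 - y k p - gstep k * c = gstep k * (g k p - c) by rewrite yg; ring.
  rewrite normrM gtr0_norm ?gstep_gt0 //.
  rewrite ler_wpM2l ?(ltW (gstep_gt0 k)) // distrC; apply: kP.
  have /andP[g1 g2] := gidx_itv k r; have /andP[g3 g4] := gidx_itv k r'.
  rewrite (gtr0_norm r0) in g1 g2; rewrite (gtr0_norm r'0) in g3 g4.
  have gk0 := ltW (gstep_gt0 k).
  have : gstep k *+ gidx k r <= gstep k *+ p by by apply: ler_wpMn2l.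
  have : gstep k *+ p.+1 <= gstep k *+ gidx k r' by by apply: ler_wpMn2l.
  rewrite mulrSr ltr_distl => h1 h2; apply/andP; split; lra.
pose d' := Num.min (d / 2) t; have d'0 : 0 < d' by rewrite lt_min d20.
apply: filterS (nbhsx_ballx (0 : R) _ d'0) => h; rewrite -ball_normE /= sub0r normrN => hd.
rewrite [h *: 1]mulr1 [h + t]addrC.
move: hd; rewrite lt_min => /andP[hd ht].
have tt : `|t - t| < d / 2 by rewrite subrr normr0.
have ht' : `|t + h - t| < d / 2 by rewrite addrAC subrr add0r.
have [h0|/ltW h0] := leP 0 h.
  have := key t (t + h) t0 _ tt ht'; rewrite lerDl => /(_ h0).
  by rewrite (_ : t + h - t = h) 1?[e * _]mulrC ?(ger0_norm h0) //; ring.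
have th : 0 < t + h by move: ht; rewrite ler0_norm //; lra.
have := key (t + h) t th _ ht' tt; rewrite gerDl => /(_ h0).
rewrite (_ : t - (t + h) = - h); last by ring.
rewrite (ler0_norm h0) [e * _]mulrC -normrN.
by congr (_ <= _); congr (`| _ |); ring.
Qed.

End GridLimit.

(* [P] is the flux [- r^m v'] of the radial equation
   [(r^m v')' + r^m G v = 0], where [m = n - 1]; the profile is extended to
   [r < 0] as an even function. *)
Definition radial_profile (R : realType) (L m : nat) (G : 'rV[R]_L -> 'rV[R]_L) (M : R)
    (v P : R -> 'rV[R]_L) : Prop :=
  [/\ forall i, continuous (fun r => v r 0 i),
      forall i, continuous (fun r => P r 0 i),
      forall i (r : R), 0 < r -> is_derive r 1 (fun r => v r 0 i) (- (r ^- m * P r 0 i)) /\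
                           is_derive r 1 (fun r => P r 0 i) (r ^+ m * G (v r) 0 i),
      forall i, P 0 0 i = 0
    & forall i (r : R), `|v r 0 i - v 0 0 i| <= M * r ^+ 2].

Section EulerLimit.
Variables (R : realType) (L m : nat) (G : 'rV[R]_L -> 'rV[R]_L) (M s : R).
Hypotheses (Gc : continuous G) (M0 : 0 <= M).
Hypotheses (G0 : forall u i, 0 <= G u 0 i) (GM : forall u i, G u 0 i <= M).
Variables (U : set_system nat) (a : nat -> 'rV[R]_L).
Hypotheses (UU : UltraFilter U) (Uoo : \oo `<=` U).
Hypothesis a_itv : forall k i, 0 <= a k 0 i <= s.

Local Notation u k j := (euler m G (gstep R k) (a k) j).1.
Local Notation P k j := (euler m G (gstep R k) (a k) j).2.

Lemma euler_limit : exists v Q : R -> 'rV[R]_L,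
  radial_profile m G M v Q /\
  forall r i, u k (gidx k r) 0 i @[k --> U] --> v r 0 i.
Proof.
have ulip i (T : R) k l : gstep R k *+ l.+1 <= T ->
    `|u k l.+1 0 i - u k l 0 i| <= gstep R k * (T * M).
  move=> lT; have := euler_u_step m (a k) (gstep_gt0 R k) G0 GM l i.
  move=> /andP[h1 h2]; rewrite distrC ger0_norm //; apply: le_trans h2 _.
  by rewrite ler_wpM2l ?(ltW (gstep_gt0 _ _)) // ler_wpM2r.
have Plip i (T : R) k l : gstep R k *+ l.+1 <= T ->
    `|P k l.+1 0 i - P k l 0 i| <= gstep R k * (T ^+ m * M).
  move=> lT; have := euler_P_step m (a k) (gstep_gt0 R k) G0 GM l i.
  move=> /andP[h1 h2]; rewrite ger0_norm //; apply: le_trans h2 _.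
  have g0 j : 0 <= gstep R k *+ j by rewrite mulrn_wge0 ?(ltW (gstep_gt0 _ _)).
  rewrite ler_wpM2l ?(ltW (gstep_gt0 _ _)) // ler_wpM2r // lerXn2r ?nnegrE //.
    exact: le_trans (g0 _) lT.
  by apply: le_trans lT; rewrite mulrSr lerDl (ltW (gstep_gt0 _ _)).
have CT0 (T : R) : 0 <= T -> 0 <= T * M by move=> T0; exact: mulr_ge0.
have CTm (T : R) : 0 <= T -> 0 <= T ^+ m * M by move=> T0; rewrite mulr_ge0 ?exprn_ge0.
have idxT k r : gstep R k *+ gidx k r <= `|r| by have /andP[] := gidx_itv k r.
have exv (r : R) i : exists l : R, u k (gidx k r) 0 i @[k --> U] --> l.
  apply: (@ultra_bounded_cvg R nat U (fun k => u k (gidx k r) 0 i) (s + `|r| * (`|r| * M)) UU) => k.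
  have h := grid_lip (y := fun k j => u k j 0 i) (C := fun T => T * M) (ulip i) (leq0n _) (idxT k r).
  have /andP[a0 as_] := a_itv k i.
  have : (gstep R k *+ gidx k r - gstep R k *+ 0) * (`|r| * M) <= `|r| * (`|r| * M).
    by rewrite mulr0n subr0 ler_wpM2r // CT0.
  have := ler_distD (u k 0%N 0 i) (u k (gidx k r) 0 i) 0.
  rewrite !subr0 /= (ger0_norm a0); lra.
have exP (r : R) i : exists l : R, P k (gidx k r) 0 i @[k --> U] --> l.
  apply: (@ultra_bounded_cvg R nat U (fun k => P k (gidx k r) 0 i) (`|r| * (`|r| ^+ m * M)) UU) => k.
  have := grid_lip (y := fun k j => P k j 0 i) (C := fun T => T ^+ m * M) (Plip i) (leq0n _) (idxT k r).
  rewrite /= mxE subr0 mulr0n subr0 => h; apply: le_trans h _.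
  by rewrite ler_wpM2r // CTm.
pose v (r : R) : 'rV[R]_L := \row_i sval (cid (exv r i)).
pose PP (r : R) : 'rV[R]_L := \row_i sval (cid (exP r i)).
have vU i r : u k (gidx k r) 0 i @[k --> U] --> v r 0 i by rewrite mxE; case: cid.
have PU i r : P k (gidx k r) 0 i @[k --> U] --> PP r 0 i by rewrite mxE; case: cid.
have ug i t : 0 <= t -> u p.1 p.2 0 i @[p --> grid_at U t] --> v t 0 i.
  exact: (limit_grid_cvg UU Uoo (y := fun k j => u k j 0 i) (C := fun T => T * M) (vU i) CT0 (ulip i)).
have Pg i t : 0 <= t -> P p.1 p.2 0 i @[p --> grid_at U t] --> PP t 0 i.
  exact: (limit_grid_cvg UU Uoo (y := fun k j => P k j 0 i) (C := fun T => T ^+ m * M) (PU i) CTm (Plip i)).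
exists v, PP; split=> //; split.
- by move=> i; exact: (limit_continuous UU Uoo (y := fun k j => u k j 0 i) (C := fun T => T * M) (vU i) CT0 (ulip i)).
- by move=> i; exact: (limit_continuous UU Uoo (y := fun k j => P k j 0 i) (C := fun T => T ^+ m * M) (PU i) CTm (Plip i)).
- move=> i r r0; split.
    apply: (@limit_is_derive R U UU Uoo (fun k j => u k j 0 i)
      (fun k j => - ((gstep R k *+ j.+1) ^- m * P k j.+1 0 i)) _ r _ (vU i)) => //.
      by move=> k j; rewrite eulerSu mulrN.
    apply: cvgN; apply: cvgM; last first.
      apply: (grid_at_shift UU Uoo (y := fun k j => P k j 0 i)).
      exact: Pg (ltW r0).
    apply: cvgV; first by rewrite expf_neq0 // gt_eqF.
    apply: (@cvg_comp _ _ _ (fun p : nat * nat => gstep R p.1 *+ p.2.+1) (fun x => x ^+ m) _ (nbhs r)).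
      exact: grid_at_next_cvg.
    exact: exprn_continuous.
  apply: (@limit_is_derive R U UU Uoo (fun k j => P k j 0 i)
      (fun k j => (gstep R k *+ j) ^+ m * G (u k j) 0 i) _ r _ (PU i)) => //.
    by move=> k j; rewrite eulerSP.
  apply: cvgM.
    apply: (@cvg_comp _ _ _ (fun p : nat * nat => gstep R p.1 *+ p.2) (fun x => x ^+ m) _ (nbhs r)).
      exact: grid_at_pos_cvg.
    exact: exprn_continuous.
  apply: (@coord_cvg _ _ _ _ _ (fun p : nat * nat => G (u p.1 p.2)) (G (v r))).
  apply: (@cvg_comp _ _ _ (fun p : nat * nat => u p.1 p.2) G _ (nbhs (v r))); last exact: Gc.
  by apply: row_cvg => j; exact: ug (ltW r0).
- move=> i; have h := PU i 0.
  have e : (fun k => P k (gidx k (0 : R)) 0 i) = cst 0.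
    by apply/funext => k; rewrite /gidx normr0 mul0r truncn0 /= mxE.
  rewrite e in h; apply: (cvg_unique _ h) => //; exact: cvg_cst.
- move=> i r.
  (* Up to radius [|r|] the slopes are at most [|r| * M], whence the quadratic bound. *)
  have := limit_lip UU Uoo (y := fun k j => u k j 0 i) (C := fun T => T * M) (vU i) (ulip i) (lexx `|r|) (_ : `|0| <= _).
  rewrite normr0 subr0 normr_id => /(_ (normr_ge0 _)) h; apply: le_trans h _.
  by rewrite mulrA mulrC -expr2 real_normK ?num_real.
Qed.

End EulerLimit.

(** * Radial functions *)

Section Enorm.
Variables (R : realType) (n : nat).
Implicit Types x : 'rV[R]_n.

Lemma sumsq_ge0 x : 0 <= \sum_(j < n) x 0 j ^+ 2.
Proof. by apply: sumr_ge0 => j _; exact: sqr_ge0. Qed.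

Lemma enorm_ge0 x : 0 <= enorm x. Proof. exact: sqrtr_ge0. Qed.

Lemma enorm_sq x : enorm x ^+ 2 = \sum_(j < n) x 0 j ^+ 2.
Proof. by rewrite sqr_sqrtr // sumsq_ge0. Qed.

Lemma coord_le_enorm x j : `|x 0 j| <= enorm x.
Proof.
rewrite -sqrtr_sqr ler_wsqrtr // (bigD1 j) //= lerDl.
by apply: sumr_ge0 => i _; exact: sqr_ge0.
Qed.

Lemma enorm0 : enorm (0 : 'rV[R]_n) = 0.
Proof. by rewrite /enorm big1 ?sqrtr0 // => j _; rewrite mxE expr0n. Qed.

Lemma enorm_eq0 x : enorm x = 0 -> x = 0.
Proof.
move=> x0; apply/rowP => j; rewrite mxE.
by apply/eqP; rewrite -normr_le0 -x0 coord_le_enorm.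
Qed.

Lemma enorm_gt0 x : x != 0 -> 0 < enorm x.
Proof. by move=> x0; rewrite lt_def enorm_ge0 andbT; apply: contra x0 => /eqP/enorm_eq0 ->. Qed.

Lemma enorm_line x k (h : R) :
  enorm (h *: delta_mx 0 k + x) = Num.sqrt (enorm x ^+ 2 + (2 * x 0 k) * h + h ^+ 2).
Proof.
congr Num.sqrt; rewrite enorm_sq (bigD1 k) //= [in RHS](bigD1 k) //=.
rewrite !mxE !eqxx mulr1 (eq_bigr (fun j => x 0 j ^+ 2)); first by ring.
by move=> j jk; rewrite !mxE eqxx (negPf jk) mulr0 add0r.
Qed.

Lemma enorm_delta k (h : R) : enorm (h *: delta_mx 0 k : 'rV[R]_n) = `|h|.
Proof.
by rewrite -[_ *: _]addr0 enorm_line enorm0 mxE mulr0 mul0r expr0n addr0 add0r sqrtr_sqr.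
Qed.

Lemma enorm_continuous : continuous (@enorm R n).
Proof.
move=> x; apply: (@cvg_comp _ _ _ (fun y : 'rV[R]_n => \sum_(j < n) y 0 j ^+ 2)
  Num.sqrt _ (nbhs (\sum_(j < n) x 0 j ^+ 2))); last exact: sqrt_continuous.
apply: cvg_big; first exact: add_continuous.
  exact: (nbhs_filter x).
move=> j _.
apply: (@cvg_comp _ _ _ (fun y : 'rV[R]_n => y 0 j) (fun z => z ^+ 2) _ (nbhs (x 0 j))).
  exact: coord_continuous.
exact: exprn_continuous.
Qed.

Lemma is_derive_line (V : normedModType R) (f : V -> R) (x v : V) (c : R) :
  is_derive (0 : R) 1 (fun h : R => f (h *: v + x)) c -> is_derive x v f c.
Proof.
case=> Df Ef.
have e : (fun h : R => h^-1 *: ((f \o shift x) (h *: v) - f x)) =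
  (fun h : R => h^-1 *: (((fun h : R => f (h *: v + x)) \o shift 0) (h *: 1) - f (0 *: v + x))).
  by apply/funext => h /=; rewrite addr0 [h *: 1]mulr1 scale0r add0r.
split; first by rewrite /derivable e; exact: Df.
by rewrite /derive e; exact: Ef.
Qed.

Lemma is_derive_enorm x k : x != 0 -> is_derive x (delta_mx 0 k) (@enorm R n) (x 0 k / enorm x).
Proof.
move=> x0; apply: is_derive_line; under eq_fun do rewrite enorm_line.
have r0 := enorm_gt0 x0.
pose p h := enorm x ^+ 2 + 2 * x 0 k * h + h ^+ 2.
have p0 : p 0 = enorm x ^+ 2 by rewrite /p mulr0 expr0n !addr0.
have Dp : is_derive (0 : R) 1 p (2 * x 0 k).
  have -> : p = cst (enorm x ^+ 2) + (2 * x 0 k) *: id + id ^+ 2 by apply/funext => h; rewrite /p.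
  by apply: is_derive_eq; rewrite /= expr1 mulr0 scale0r addr0 add0r [_ *: 1]mulr1.
have Ds : is_derive (p 0) 1 Num.sqrt (2 * enorm x)^-1.
  rewrite p0; have := @is_derive1_sqrt R (enorm x ^+ 2); rewrite exprn_gt0 // => /(_ isT).
  by rewrite sqrtr_sqr gtr0_norm.
have := @is_derive1_comp R Num.sqrt p 0 _ _ Ds Dp.
by rewrite (_ : _ * _ = x 0 k / enorm x) //; field; rewrite gt_eqF.
Qed.

Lemma is_derive_radial (f : R -> R) (c : R) x k : x != 0 -> is_derive (enorm x) 1 f c ->
  is_derive x (delta_mx 0 k) (fun y => f (enorm y)) (c * (x 0 k / enorm x)).
Proof.
move=> x0 Df; apply: is_derive_line.
have De : is_derive (0 : R) 1 (fun h : R => enorm (h *: delta_mx 0 k + x)) (x 0 k / enorm x).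
  have [De Ee] := is_derive_enorm k x0.
  have e : (fun h : R => h^-1 *: ((@enorm R n \o shift x) (h *: delta_mx 0 k) - enorm x)) =
    (fun h : R => h^-1 *: (((fun h : R => enorm (h *: delta_mx 0 k + x)) \o shift 0) (h *: 1)
                           - enorm (0 *: delta_mx 0 k + x))).
    by apply/funext => h /=; rewrite addr0 [h *: 1]mulr1 scale0r add0r.
  by split; [rewrite /derivable -e; exact: De|rewrite /derive -e; exact: Ee].
have Df' : is_derive (enorm (0 *: delta_mx 0 k + x)) 1 f c by rewrite scale0r add0r.
exact: (@is_derive1_comp R f (fun h : R => enorm (h *: delta_mx 0 k + x)) 0 _ _ Df' De).
Qed.

Lemma is_derive_coord x j k :
  is_derive x (delta_mx 0 k) (fun y : 'rV[R]_n => y 0 j) ((j == k)%:R : R).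
Proof.
apply: is_derive_near => e e0; near=> h.
by rewrite !mxE eqxx /= addrK subrr normr0 mulr_ge0 // ltW.
Unshelve. all: by end_near.
Qed.

End Enorm.

Section RadialRegularity.
Variables (R : realType) (n : nat) (v q g : R -> R) (M : R).
Hypotheses (vc : continuous v) (qc : continuous q) (gc : continuous g).
Hypothesis vM : forall r : R, `|v r - v 0| <= M * r ^+ 2.
Hypothesis v' : forall r : R, 0 < r -> is_derive r 1 v (r * q r).
Hypothesis q' : forall r : R, 0 < r -> is_derive r 1 q ((- g r - n%:R * q r) / r).
Hypothesis q0 : n%:R * q 0 = - g 0.

Let u (x : 'rV[R]_n) := v (enorm x).
(** Here [q] is [v' / r], so the gradient of [u] is [q x], and [e] is [r] times the derivative of
    [q]. The Hessian [D2] below is [q] times the identity plus [e] times the projection on the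
    direction of [x]. *)
Let e (r : R) := - g r - n%:R * q r.

Let is_derive_u x j : is_derive x (delta_mx 0 j) u (q (enorm x) * x 0 j).
Proof.
have [->|x0] := eqVneq x 0; last first.
  have r0 := enorm_gt0 x0.
  apply: is_derive_eq (is_derive_radial j x0 (v' r0)) _.
  by field; rewrite gt_eqF.
(* [enorm] is not differentiable at the origin; there the quadratic bound [vM] gives derivative
   zero. *)
rewrite mxE mulr0; apply: is_derive_near => eps eps0.
have M0 : 0 <= M by have := vM 1; rewrite expr1n mulr1; exact: le_trans.
have M1 : 0 < M + 1 by rewrite ltr_wpDl.
have d0 : 0 < eps / (M + 1) by rewrite divr_gt0.
apply: filterS (nbhsx_ballx (0 : R) _ d0) => h; rewrite -ball_normE /= sub0r normrN.
rewrite ltr_pdivlMr // => hd; rewrite mulr0 subr0 addr0 /u enorm_delta enorm0.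
apply: le_trans (vM _) _; rewrite expr2 mulrA ler_wpM2r //.
have := normr_ge0 h; lra.
Qed.

Let D2 j k (x : 'rV[R]_n) :=
  q (enorm x) * (j == k)%:R + e (enorm x) * (x 0 j * x 0 k / enorm x ^+ 2).

Let is_derive_pu x j k :
  is_derive x (delta_mx 0 k) (fun y : 'rV[R]_n => q (enorm y) * y 0 j) (D2 j k x).
Proof.
have [->|x0] := eqVneq x 0; last first.
  have r0 := enorm_gt0 x0.
  have Dq := is_derive_radial k x0 (q' r0).
  apply: is_derive_eq (is_deriveM Dq (is_derive_coord x j k)) _.
  rewrite /D2 /e /=; congr (_ + _); rewrite -[_ *: _]/(_ * _).
  by field; rewrite gt_eqF.
rewrite /D2 mxE mul0r mul0r mulr0 addr0 enorm0.
apply: is_derive_near => eps eps0.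
have /cvgrPdist_le/(_ _ eps0)/nbhs_ballP[d /= d0 dP] := @qc (0 : R).
apply: filterS (nbhsx_ballx (0 : R) _ d0) => h; rewrite -ball_normE /= sub0r normrN => hd.
rewrite addr0 enorm_delta !mxE eqxx /= mulr0 subr0.
have -> : q `|h| * (h * (j == k)%:R) - h * (q 0 * (j == k)%:R) =
  (q `|h| - q 0) * (h * (j == k)%:R) by ring.
rewrite normrM ler_pM // ?normrM.
  by rewrite distrC; apply: dP; rewrite -ball_normE /= sub0r normrN normr_id.
by case: (j == k); rewrite ?normr1 ?mulr1 // normr0 mulr0.
Qed.

Lemma radial_partial j : partial j u = fun x => q (enorm x) * x 0 j.
Proof. by apply/funext => x; rewrite /partial; have [_ ->] := is_derive_u x j. Qed.

Lemma radial_partial2 j k : partial k (partial j u) = D2 j k.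
Proof. by rewrite radial_partial; apply/funext => x; have [_ <-] := is_derive_pu x j k. Qed.

Let comp_continuous (f : R -> R) : continuous f -> continuous (fun x : 'rV[R]_n => f (enorm x)).
Proof.
move=> fc x; apply: (@continuous_comp _ _ _ (@enorm R n) f); last exact: fc.
exact: enorm_continuous.
Qed.

Let e_continuous : continuous e.
Proof. by move=> r; apply: cvgB; [apply: cvgN; exact: gc|apply: cvgMl_tmp; exact: qc]. Qed.

Let D2_continuous j k : continuous (D2 j k).
Proof.
move=> x; apply: (@cvgD _ _ _ (nbhs x) _ (fun y : 'rV[R]_n => q (enorm y) * (j == k)%:R)
    (fun y : 'rV[R]_n => e (enorm y) * (y 0 j * y 0 k / enorm y ^+ 2))).
  apply: (@cvgMr_tmp _ _ (nbhs x) _ (fun y : 'rV[R]_n => q (enorm y))); exact: comp_continuous.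
have [->|x0] := eqVneq x 0; last first.
  apply: (@cvgM _ _ (nbhs x) _ (fun y : 'rV[R]_n => e (enorm y))
    (fun y : 'rV[R]_n => y 0 j * y 0 k / enorm y ^+ 2)); first exact: comp_continuous.
  apply: (@cvgM _ _ (nbhs x) _ (fun y : 'rV[R]_n => y 0 j * y 0 k)
    (fun y : 'rV[R]_n => (enorm y ^+ 2)^-1)).
    by apply: (@cvgM _ _ (nbhs x) _ (fun y : 'rV[R]_n => y 0 j) (fun y : 'rV[R]_n => y 0 k));
      exact: coord_continuous.
  apply: cvgV; first by rewrite expf_neq0 // gt_eqF // enorm_gt0.
  apply: (@cvg_comp _ _ _ (@enorm R n) (fun z => z ^+ 2) _ (nbhs (enorm x))).
    exact: enorm_continuous.
  exact: exprn_continuous.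
rewrite mxE !mul0r mulr0.
apply/cvgrPdist_le => eps eps0.
(* The quotient [x_j x_k / |x|^2] need not have a limit at the origin, but it is bounded by 1 and
   [e] vanishes there by [q0]. *)
have e0 : e (enorm (0 : 'rV[R]_n)) = 0 by rewrite enorm0 /e q0 opprK addNr.
have /cvgrPdist_le/(_ _ eps0) := @comp_continuous _ e_continuous (0 : 'rV[R]_n).
apply: filterS => z; rewrite e0 !sub0r !normrN => H.
rewrite normrM -[leRHS]mulr1 ler_pM //.
have [->|z0] := eqVneq z 0; first by rewrite mxE !mul0r normr0.
have r0 := enorm_gt0 z0.
rewrite !normrM normfV (ger0_norm (exprn_ge0 _ (enorm_ge0 _))).
rewrite ler_pdivrMr ?exprn_gt0 // mul1r expr2.
by rewrite ler_pM // coord_le_enorm.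
Qed.

Lemma radial_C2 : C2_on setT u.
Proof.
move=> x _; split.
- exact: comp_continuous.
- move=> j; split; first by have [] := is_derive_u x j.
  rewrite radial_partial; apply: (@cvgM _ _ (nbhs x) _ (fun y : 'rV[R]_n => q (enorm y))
    (fun y : 'rV[R]_n => y 0 j)); [exact: comp_continuous|exact: coord_continuous].
- move=> j k; split; last by rewrite radial_partial2; exact: D2_continuous.
  by rewrite radial_partial; have [] := is_derive_pu x j k.
Qed.

(** Away from the origin the trace of [D2] is [n q + e = - g]; at the origin [q0] gives the same
    value. *)
Lemma radial_laplacian x : - laplacian u x = g (enorm x).
Proof.
rewrite /laplacian; under eq_bigr do rewrite radial_partial2.
rewrite /D2 big_split /= -!mulr_sumr.
under eq_bigr do rewrite eqxx.
rewrite sumr_const card_ord.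
have [->|x0] := eqVneq x 0.
  rewrite enorm0 big1 ?mulr0 ?addr0 => [|j _]; last by rewrite mxE !mul0r.
  by rewrite mulrC q0 opprK.
rewrite -mulr_suml; under eq_bigr do rewrite -expr2.
rewrite -enorm_sq divff ?expf_neq0 ?gt_eqF ?enorm_gt0 //.
by rewrite /e /=; ring.
Qed.

End RadialRegularity.

(** * Radial profiles *)

Lemma is_derive_near_eq (R : realType) (f h : R -> R) (x c : R) :
  (\near x, f x = h x) -> is_derive x 1 f c -> is_derive x 1 h c.
Proof.
move=> fh Df; split.
  by apply: near_eq_derivable fh _ => //; rewrite oner_eq0.
by rewrite -(near_eq_derive _ fh) ?oner_eq0 //; have [_ ->] := Df.
Qed.

Section Profile.
Variables (R : realType) (L m : nat) (G : 'rV[R]_L -> 'rV[R]_L) (M : R).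
Variables (v P : R -> 'rV[R]_L).
Hypothesis vP : radial_profile m G M v P.
Hypothesis Gc : continuous G.
Hypothesis G0 : forall u i, 0 <= G u 0 i.
Local Notation n := m.+1.
Local Notation g i := (fun r => G (v r) 0 i).

Let v_cont i : continuous (fun r => v r 0 i). Proof. by case: vP => + _ _ _ _; exact. Qed.
Let P_cont i : continuous (fun r => P r 0 i). Proof. by case: vP => _ + _ _ _; exact. Qed.
Let v_derive i (r : R) : 0 < r -> is_derive r 1 (fun r => v r 0 i) (- (r ^- m * P r 0 i)).
Proof. by case: vP => _ _ + _ _ r0 => /(_ i r r0)[]. Qed.
Let P_derive i (r : R) : 0 < r -> is_derive r 1 (fun r => P r 0 i) (r ^+ m * G (v r) 0 i).
Proof. by case: vP => _ _ + _ _ r0 => /(_ i r r0)[]. Qed.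
Let P0 i : P 0 0 i = 0. Proof. by case: vP => _ _ _ + _; exact. Qed.

Lemma profile_continuous : continuous v.
Proof. by move=> r; apply: row_cvg => i; exact: v_cont. Qed.

Lemma profile_source_continuous i : continuous (g i).
Proof.
move=> r; apply: (@coord_cvg R L R (nbhs r) _ (fun r => G (v r))).
by apply: (@continuous_comp _ _ _ v G); [exact: profile_continuous|exact: Gc].
Qed.

Let mvt (f df : R -> R) (a b : R) : 0 <= a -> a < b -> continuous f ->
  (forall r : R, 0 < r -> is_derive r 1 f (df r)) ->
  exists2 c, a < c < b & f b - f a = df c * (b - a).
Proof.
move=> a0 ab fc fd.
have [|c] := @MVT R f df a b ab _ (continuous_subspaceT fc).
  by move=> r; rewrite in_itv /= => /andP[ar _]; apply: fd; exact: le_lt_trans ar.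
by rewrite in_itv /= => acb e; exists c.
Qed.

Let is_derive_expn (r : R) : is_derive r 1 (fun r : R => r ^+ n) (n%:R * r ^+ m).
Proof.
by split; [exact: exprn_derivable|rewrite exp_derive /= [_ *: 1]mulr1].
Qed.

(* Monotonicity of [P r - c r^n / n]. *)
Lemma flux_compare i (a b c : R) : 0 <= a -> a < b ->
  exists2 r, a < r < b & P b 0 i - P a 0 i - c * (b ^+ n - a ^+ n) / n%:R =
                         r ^+ m * (G (v r) 0 i - c) * (b - a).
Proof.
move=> a0 ab.
pose f (r : R) := P r 0 i - c / n%:R * r ^+ n.
have fc : continuous f.
  move=> r; apply: cvgB; first exact: P_cont.
  by apply: cvgMl_tmp; exact: exprn_continuous.
have fd (r : R) : 0 < r -> is_derive r 1 f (r ^+ m * (G (v r) 0 i - c)).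
  move=> r0; have DP := P_derive i r0.
  have Dn := is_derive_expn r.
  have -> : f = (fun r => P r 0 i) - (c / n%:R) *: (fun r : R => r ^+ n) by [].
  apply: is_derive_eq; rewrite -[_ *: _]/(_ * _).
  have [N N0 <-] : exists2 N : R, N != 0 & N = n%:R by exists n%:R; rewrite ?pnatr_eq0.
  by field.
have [r rab e] := mvt a0 ab fc fd; exists r => //; rewrite -e /f.
have [N N0 <-] : exists2 N : R, N != 0 & N = n%:R by exists n%:R; rewrite ?pnatr_eq0.
by field.
Qed.

Lemma flux_ge i (a b c : R) : 0 <= a -> a <= b ->
  (forall r : R, a < r < b -> c <= G (v r) 0 i) ->
  c * (b ^+ n - a ^+ n) / n%:R <= P b 0 i - P a 0 i.
Proof.
move=> a0; rewrite le_eqVlt => /orP[/eqP <-|ab] H; first by rewrite !subrr mulr0 mul0r.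
have [r /andP[ar rb] e] := flux_compare i c a0 ab.
rewrite -subr_ge0 e !mulr_ge0 ?subr_ge0 ?(ltW ab) ?H ?ar //.
by rewrite exprn_ge0 // (le_trans a0) // ltW.
Qed.

Lemma flux_le i (a b c : R) : 0 <= a -> a <= b ->
  (forall r : R, a < r < b -> G (v r) 0 i <= c) ->
  P b 0 i - P a 0 i <= c * (b ^+ n - a ^+ n) / n%:R.
Proof.
move=> a0; rewrite le_eqVlt => /orP[/eqP <-|ab] H; first by rewrite !subrr mulr0 mul0r.
have [r /andP[ar rb] e] := flux_compare i c a0 ab.
rewrite -subr_le0 e mulr_le0_ge0 ?subr_ge0 ?(ltW ab) // mulr_ge0_le0 ?subr_le0 ?H ?ar //.
by rewrite exprn_ge0 // (le_trans a0) // ltW.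
Qed.

Lemma flux_homo i (a b : R) : 0 <= a -> a <= b -> P a 0 i <= P b 0 i.
Proof.
move=> a0 ab; have := @flux_ge i a b 0 a0 ab (fun r _ => G0 _ _).
by rewrite !mul0r subr_ge0.
Qed.

Lemma flux_ge0 i (r : R) : 0 <= r -> 0 <= P r 0 i.
Proof. by move=> r0; rewrite -(P0 i) flux_homo. Qed.

Lemma profile_le i (a b c : R) : 0 <= a -> a <= b ->
  (forall r : R, a < r < b -> c <= r ^- m * P r 0 i) -> v b 0 i <= v a 0 i - c * (b - a).
Proof.
move=> a0; rewrite le_eqVlt => /orP[/eqP <-|ab] H; first by rewrite subrr mulr0 subr0.
have [r rab e] := mvt a0 ab (v_cont (i := i)) (v_derive i).
have : c * (b - a) <= r ^- m * P r 0 i * (b - a).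
  by rewrite ler_wpM2r ?subr_ge0 ?(ltW ab) // H.
by move: e; rewrite mulNr; lra.
Qed.

Lemma profile_nincr i (a b : R) : 0 <= a -> a <= b -> v b 0 i <= v a 0 i.
Proof.
move=> a0 ab; have := @profile_le i a b 0 a0 ab; rewrite mul0r subr0; apply.
move=> r /andP[ar _]; have r0 : 0 <= r by exact: le_trans (ltW ar).
by rewrite mulr_ge0 ?flux_ge0 // invr_ge0 exprn_ge0.
Qed.

(* The value at [r <= 0] is the limit of [v' / r] at [0+]. *)
Let q i (r : R) : R := if 0 < r then - (r ^- n * P r 0 i) else - (G (v 0) 0 i / n%:R).

Let q_derive i (r : R) : 0 < r ->
  is_derive r 1 (q i) ((- G (v r) 0 i - n%:R * q i r) / r).
Proof.
move=> r0; have DP := P_derive i r0.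
apply: (@is_derive_near_eq _ (- ((fun r => (r ^+ n)^-1) * (fun r => P r 0 i)))).
  have : \forall t \near r, 0 < t by exact: lt_nbhsr.
  by apply: filterS => t t0; rewrite /q t0.
have DX : is_derive r 1 (fun r : R => (r ^+ n)^-1) (- (n%:R * r ^+ m) / (r ^+ n) ^+ 2).
  have Dn := is_derive_expn r.
  have rn0 : r ^+ n != 0 by rewrite expf_neq0 // gt_eqF.
  have := @is_deriveV R (fun r : R => r ^+ n) r (n%:R * r ^+ m) 1 rn0 Dn.
  by move=> D; apply: is_derive_eq D _; rewrite -[_ *: _]/(_ * _) !mulNr mulrC.
apply: is_derive_eq; rewrite /q r0 -![_ *: _]/(_ * _) /= !exprS.
have rm : r ^+ m != 0 by rewrite expf_neq0 // gt_eqF.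
by field; rewrite rm gt_eqF.
Qed.

Let q_continuous i : continuous (q i).
Proof.
move=> r; have [r0|r0|r0] := ltgtP r 0.
- have H : \forall t \near r, q i r = q i t.
    have : \forall t \near r, t < 0 by exact: lt_nbhsl.
    by apply: filterS => t t0; rewrite /q !ltNge (ltW r0) (ltW t0).
  by apply/cvgrPdist_le => e e0; apply: filterS H => t <-; rewrite subrr normr0 ltW.
- apply/differentiable_continuous/derivable1_diffP.
  by have [] := q_derive i r0.
rewrite {}r0 {r}.
apply/cvgrPdist_le => e e0.
have /cvgrPdist_le/(_ _ e0)/nbhs_ballP[d /= d0 dP] := @profile_source_continuous i 0.
apply: filterS (nbhsx_ballx (0 : R) _ d0) => r; rewrite -ball_normE /= sub0r normrN => rd.
rewrite {1}/q ltxx /q; case: ifPn => r0; last by rewrite subrr normr0 ltW.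
rewrite (gtr0_norm r0) in rd.
have rn : 0 < r ^+ n by rewrite exprn_gt0.
have n0 : 0 < n%:R :> R by rewrite ltr0n.
have gr (t : R) : 0 < t < r -> `|G (v 0) 0 i - G (v t) 0 i| <= e.
  move=> /andP[t0 tr]; apply: dP; rewrite -ball_normE /= sub0r normrN gtr0_norm //.
  exact: lt_trans rd.
(* On the interval from 0 to [r] the source is within [e] of its value at 0, so the two flux bounds
   squeeze [P r / r^n]. *)
have := @flux_le i 0 r (G (v 0) 0 i + e) (lexx _) (ltW r0).
have := @flux_ge i 0 r (G (v 0) 0 i - e) (lexx _) (ltW r0).
rewrite P0 expr0n /= !subr0 => h1 h2.
have {}h1 : (G (v 0) 0 i - e) / n%:R <= P r 0 i / r ^+ n.
  by rewrite ler_pdivlMr // mulrAC; apply: h1 => t /gr; rewrite ler_distlC => /andP[].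
have {}h2 : P r 0 i / r ^+ n <= (G (v 0) 0 i + e) / n%:R.
  by rewrite ler_pdivrMr // [leRHS]mulrAC; apply: h2 => t /gr; rewrite ler_distlC => /andP[].
have en : e / n%:R <= e by rewrite ler_pdivrMr // ler_peMr ?(ltW e0) // ler1n.
rewrite (mulrC _ (P r 0 i)) ler_distl; move: h1 h2; rewrite mulrBl mulrDl.
move: en; move: (P r 0 i / r ^+ n) (G (v 0) 0 i / n%:R) (e / n%:R) => A B C en h1 h2.
by apply/andP; split; lra.
Qed.

Let qE i (r : R) : 0 < r -> r * q i r = - (r ^- m * P r 0 i).
Proof.
move=> r0; rewrite /q r0 exprS.
have rm : r ^+ m != 0 by rewrite expf_neq0 // gt_eqF.
by field; rewrite rm gt_eqF.
Qed.

Let v_derive_q i (r : R) : 0 < r -> is_derive r 1 (fun r => v r 0 i) (r * q i r).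
Proof. by move=> r0; rewrite qE //; exact: v_derive. Qed.

Let q0 i : n%:R * q i 0 = - G (v 0) 0 i.
Proof. by rewrite /q ltxx mulrN mulrCA mulfV ?mulr1 // pnatr_eq0. Qed.

Let v_quad i (r : R) : `|v r 0 i - v 0 0 i| <= M * r ^+ 2.
Proof. by case: vP => _ _ _ _; exact. Qed.

Lemma profile_C2 i : C2_on setT (fun x : 'rV[R]_n => v (enorm x) 0 i).
Proof.
exact: (radial_C2 (v_cont (i := i)) (q_continuous (i := i))
  (@profile_source_continuous i) (v_quad i) (v_derive_q i) (q_derive i) (q0 i)).
Qed.

Lemma profile_laplacian i (x : 'rV[R]_n) :
  - laplacian (fun x : 'rV[R]_n => v (enorm x) 0 i) x = G (v (enorm x)) 0 i.
Proof.
exact: (radial_laplacian (q_continuous (i := i))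
  (v_quad i) (v_derive_q i) (q_derive i) (q0 i)).
Qed.

(* A positive limit of the source would make [r^m v'] decrease like [- r^n],
   driving the profile to [- oo]. *)
Lemma profile_limit : (forall (r : R) i, 0 <= r -> 0 <= v r 0 i) ->
  exists l : 'rV[R]_L, [/\ v r @[r --> +oo] --> l,
    forall (r : R) i, 0 <= r -> 0 <= l 0 i <= v r 0 i & forall i, G l 0 i = 0].
Proof.
move=> v0.
pose E i := [set x | exists2 r : R, 0 <= r & x = v r 0 i].
have hE i : has_inf (E i).
  split; first by exists (v 0 0 i), 0.
  by exists 0 => _ [r r0 ->]; exact: v0.
pose l : 'rV[R]_L := \row_i inf (E i).
have lv (r : R) i : 0 <= r -> 0 <= l 0 i <= v r 0 i.
  move=> r0; rewrite mxE; apply/andP; split.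
    apply: lb_le_inf; first exact: (hE i).1.
    by move=> _ [t t0 ->]; exact: v0.
  by apply: (ge_inf (hE i).2); exists r.
have vl : v r @[r --> +oo] --> l.
  apply: row_cvg => i; apply/cvgrPdist_lt => e e0.
  have [_ [r r0 ->] re] := inf_adherent e0 (hE i).
  near=> t; have rt : r <= t by near: t; apply: nbhs_pinfty_ge; exact: num_real.
  have t0 : 0 <= t := le_trans r0 rt.
  have /andP[_ h] := lv t i t0; rewrite distrC ger0_norm ?subr_ge0 //.
  have := profile_nincr i r0 rt; move: re; rewrite ?mxE; lra.
exists l; split=> // i; apply/eqP; apply: contraT => Gl0.
have Gl : 0 < G l 0 i by rewrite lt_def Gl0 G0.
pose c := G l 0 i / 2; have c0 : 0 < c by rewrite divr_gt0.
have : \forall r \near +oo, c <= G (v r) 0 i.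
  have : G (v r) 0 i @[r --> +oo] --> G l 0 i.
    apply: (@coord_cvg R L R (pinfty_nbhs R) _ (fun r => G (v r))).
    by apply: (@cvg_comp _ _ _ v G _ (nbhs l)) => //; exact: Gc.
  move=> /cvgrPdist_le/(_ _ c0); apply: filterS => r; rewrite ler_distlC /c; lra.
case=> A [_ AP]; pose r0 := Num.max 1 A.
have r01 : 1 <= r0 by rewrite le_max lexx.
have rA (r : R) : r0 < r -> c <= G (v r) 0 i.
  by rewrite gt_max => /andP[_ /AP].
have r00 : 0 <= r0 by exact: le_trans r01.
have n0 : 0 < n%:R :> R by rewrite ltr0n.
pose k := c / n%:R; have k0 : 0 < k by rewrite divr_gt0.
(* For [r > r0 + 1], [r^n - r0^n] is at least [r^m (r - r0)], hence at least [r^m]. *)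
have key (r : R) : r0 + 1 < r -> k <= r ^- m * P r 0 i.
  move=> r1; have r0r : r0 < r by lra.
  have rp : 0 < r by exact: le_lt_trans r0r.
  have H : k * (r ^+ n - r0 ^+ n) <= P r 0 i.
    rewrite /k mulrAC; apply: le_trans (_ : _ <= P r 0 i - P r0 0 i) _.
      by apply: flux_ge => // [|t /andP[/rA]]; first exact: ltW.
    by rewrite gerBl flux_ge0.
  rewrite mulrC ler_pdivlMr ?exprn_gt0 //; apply: le_trans H.
  rewrite ler_wpM2l ?(ltW k0) // !exprS.
  have : r0 ^+ m <= r ^+ m by rewrite lerXn2r ?nnegrE // ltW.
  have : 0 <= r ^+ m by rewrite exprn_ge0 // ltW.
  move=> rm r0m; have : r0 * r0 ^+ m <= r0 * r ^+ m by rewrite ler_wpM2l.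
  have : (r0 + 1) * r ^+ m <= r * r ^+ m by rewrite ler_wpM2r // ltW.
  lra.
have r10 : 0 <= r0 + 1 by lra.
(* Descending at rate at least [k] from radius [r0 + 1], the profile is at most -1 at [b]. *)
pose b := r0 + 1 + (v (r0 + 1) 0 i + 1) / k.
have vr1 := v0 (r0 + 1) i r10.
have r1b : r0 + 1 <= b by rewrite lerDl divr_ge0 ?(ltW k0) //; lra.
have := @profile_le i (r0 + 1) b k r10 r1b (fun t tb => key t (proj1 (andP tb))).
have := v0 b i (le_trans r10 r1b).
have -> : k * (b - (r0 + 1)) = v (r0 + 1) 0 i + 1.
  by rewrite /b; field; rewrite gt_eqF.
lra.
Unshelve. all: by end_near.
Qed.

End Profile.

(** * The shooting argument *)

Section Clip.
Variables (R : realType) (L : nat) (a : R).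
Hypothesis a0 : 0 <= a.

(** Composing with [clip] makes [F] continuous, bounded and nonnegative on the whole space, so the
    Euler scheme and the equation continue past the touching radius, where components become
    negative. *)
Definition clip (u : 'rV[R]_L) : 'rV[R]_L := \row_i Num.min a (Num.max 0 (u 0 i)).

Lemma clip_itv (u : 'rV[R]_L) i : 0 <= clip u 0 i <= a.
Proof. by rewrite mxE le_min a0 le_max lexx /= ge_min lexx. Qed.

Lemma clip_id (u : 'rV[R]_L) : (forall i, 0 <= u 0 i <= a) -> clip u = u.
Proof.
move=> H; apply/rowP => i; have /andP[h1 h2] := H i.
by rewrite mxE (max_idPr h1) (min_idPr h2).
Qed.

Lemma clip_continuous : continuous clip.
Proof.
move=> u; apply: (@row_cvg _ _ _ (nbhs u) (nbhs_filter u)) => i.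
have -> : (fun x => clip x 0 i) = (fun x : 'rV[R]_L => Num.min a (Num.max 0 (x 0 i))).
  by apply/funext => x; rewrite mxE.
rewrite mxE.
apply: (@continuous_min _ _ (cst a) (fun x : 'rV[R]_L => Num.max 0 (x 0 i)) u).
  exact: cst_continuous.
apply: (@continuous_max _ _ (cst 0) (fun x : 'rV[R]_L => x 0 i) u).
  exact: cst_continuous.
exact: coord_continuous.
Qed.

Variable F : 'rV[R]_L -> 'rV[R]_L.
Hypothesis F_cont : {within @orthant R L, continuous F}.

Lemma comp_clip_continuous : continuous (fun u => F (clip u)).
Proof.
move=> u; have oc w : orthant (clip w) by move=> i; have /andP[] := clip_itv w i.
have := (subspace_continuousP _ _).1 F_cont (clip u) (oc u).
move=> Fc V /Fc; rewrite /= /within /= => /clip_continuous.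
by move=> H; apply: (@filterS _ _ (nbhs_filter u) _ _ _ H) => w; exact.
Qed.

Lemma comp_clip_bounded : exists2 M : R, 0 <= M & forall u i, F (clip u) 0 i <= M.
Proof.
pose K := [set x : 'rV[R]_L | forall i, `[0, a]%classic (x 0 i)].
have cK : compact K by apply: (@rV_compact R L (fun=> `[0, a]%classic)) => i; exact: segment_compact.
have /compact_bounded[N [_ H]] :=
  continuous_compact (continuous_subspaceT comp_clip_continuous) cK.
pose M := Num.max 0 (N + 1); exists M; first by rewrite le_max lexx.
move=> u i; have NM : N < M by rewrite lt_max ltrDl ltr01 orbT.
have Ku : K (clip u) by move=> j; rewrite /= in_itv /= clip_itv.
have := H M NM (F (clip u)); rewrite /= => /(_ _) h.
apply: le_trans (ler_norm _) _; apply: le_trans (coord_norm_le _ i) _; apply: h.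
by exists (clip u) => //; rewrite clip_id // => j; exact: clip_itv.
Qed.

End Clip.

(** The permutation lists the positive coordinates first and [k] is their number; a positive sum has
    a positive term. *)
Lemma non_degenerate_pos (R : realType) (L : nat) (F : 'rV[R]_L -> 'rV[R]_L) (u : 'rV[R]_L) :
  non_degenerate F -> orthant u -> (exists i, 0 < u 0 i) -> (exists i, u 0 i = 0) ->
  exists2 i, u 0 i = 0 & 0 < F u 0 i.
Proof.
move=> Fn ou [i0 ui0] [i1 ui1].
pose A := [pred i : 'I_L | 0 < u 0 i].
pose l := enum A ++ enum (predC A).
have sl : size l = L by rewrite size_cat -!cardE cardC card_ord.
have ul : uniq l.
  rewrite cat_uniq !enum_uniq /= andbT; apply/hasPn => i.
  by rewrite !mem_enum !inE.
pose f (j : 'I_L) := nth i0 l j.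
have finj : injective f.
  by move=> j k /eqP; rewrite nth_uniq ?sl // => /eqP/val_inj.
pose k := size (enum A).
have kL : (k <= L)%N by rewrite -sl size_cat leq_addr.
have zero (j : 'I_L) : (k <= j)%N -> u 0 (perm finj j) = 0.
  move=> kj; rewrite permE /f nth_cat ltnNge kj /=.
  have : (j - k < size (enum (predC A)))%N.
    by rewrite ltn_subLR // -[X in (_ < X)%N]size_cat sl.
  move=> /(mem_nth i0); rewrite mem_enum !inE -leNgt => h.
  by apply/eqP; rewrite eq_le h ou.
have S0 : 0 < \sum_(j < L | (k <= j)%N) F u 0 (perm finj j).
  apply: Fn => [|//|j jk|//].
    rewrite /k -cardE; apply/andP; split; first by apply/card_gt0P; exists i0.
    rewrite -[X in (_ < X)%N](card_ord L) -(cardC A) -addn1 leq_add2l.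
    by apply/card_gt0P; exists i1; rewrite !inE ui1 ltxx.
  by rewrite permE /f nth_cat jk; have := mem_nth i0 jk; rewrite mem_enum.
have /existsP[j /andP[kj Fj]] :
    [exists j : 'I_L, (k <= j)%N && (0 < F u 0 (perm finj j))].
  apply: contraLR S0; rewrite negb_exists => /forallP H; rewrite -leNgt.
  by apply: sumr_le0 => j kj; have := H j; rewrite kj /= leNgt.
exists (perm finj j) => //; exact: zero.
Qed.

Lemma enorm_le_sum (R : realType) (L : nat) (u : 'rV[R]_L) :
  orthant u -> enorm u <= \sum_i u 0 i.
Proof.
move=> ou; have s0 : 0 <= \sum_i u 0 i by apply: sumr_ge0 => i _; exact: ou.
rewrite -[leRHS](ger0_norm s0) -sqrtr_sqr ler_wsqrtr // expr2 mulr_suml.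
apply: ler_sum => i _; rewrite expr2 ler_wpM2l ?ou // (bigD1 i) //= lerDl.
by apply: sumr_ge0 => j _; exact: ou.
Qed.

Lemma boundary_eball (R : realType) (n : nat) (r : R) (x : 'rV[R]_n) :
  boundary (eball r) x -> enorm x = r.
Proof.
case=> cx ix; apply/eqP; rewrite eq_le; apply/andP; split.
  have cl : closed [set y : 'rV[R]_n | enorm y <= r].
    apply: (closed_comp (f := @enorm R n) (D := [set t | t <= r])); last exact: closed_le.
    by move=> y _; exact: enorm_continuous.
  have := closure_subset (_ : eball r `<=` [set y : 'rV[R]_n | enorm y <= r]).
  move=> /(_ (fun y => @ltW _ _ _ _) x cx).
  by rewrite -((closure_id _).1 cl).
rewrite leNgt; apply/negP => xr; apply: ix.
have op : open (eball r : set 'rV[R]_n).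
  apply: (open_comp (f := @enorm R n) (D := [set t | t < r])); last exact: open_lt.
  by move=> y _; exact: enorm_continuous.
by apply: open_nbhs_nbhs; split.
Qed.

Lemma cst_C2 (R : realType) (n : nat) (c : R) : C2_on [set: 'rV[R]_n] (cst c) /\
  forall x, - laplacian (cst c : 'rV[R]_n -> R) x = 0.
Proof.
have cc d : continuous (cst d : R -> R) by exact: cst_continuous.
have vM (r : R) : `|(cst c : R -> R) r - (cst c : R -> R) 0| <= 0 * r ^+ 2 by rewrite /= subrr normr0 mul0r.
have v' (r : R) : 0 < r -> is_derive r 1 (cst c) (r * cst 0 r).
  by move=> _; rewrite /= mulr0; exact: is_derive_cst.
have q' (r : R) : 0 < r -> is_derive r 1 (cst (0 : R)) ((- cst 0 r - n%:R * cst 0 r) / r).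
  by move=> _; rewrite /= mulr0 subr0 oppr0 mul0r; exact: is_derive_cst.
have q0 : n%:R * (cst 0 : R -> R) 0 = - (cst 0 : R -> R) 0 by rewrite /= mulr0 oppr0.
split; first exact: (@radial_C2 R n _ _ _ _ (cc c) (cc 0) (cc 0) vM v' q' q0).
exact: (@radial_laplacian R n _ _ _ _ (cc 0) vM v' q' q0).
Qed.

(** A positive source makes the flux positive right after [r0], and then the profile decreases
    strictly. The flux is gained between [r0] and [s], the drop is measured between [s] and [r1]. *)
Lemma profile_drops (R : realType) (L m : nat) (G : 'rV[R]_L -> 'rV[R]_L) (M : R)
    (v P : R -> 'rV[R]_L) (r0 d : R) (i : 'I_L) :
  radial_profile m G M v P -> continuous G -> (forall u i, 0 <= G u 0 i) ->
  0 <= r0 -> 0 < d -> v r0 0 i <= 0 -> 0 < G (v r0) 0 i ->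
  exists2 r1, r0 < r1 < r0 + d & v r1 0 i < 0.
Proof.
move=> vP Gc G0 r00 d0 vi Gi.
have c0 : 0 < G (v r0) 0 i / 2 by rewrite divr_gt0.
have /cvgrPdist_lt/(_ _ c0)/nbhs_ballP[e /= e0 eP] :=
  profile_source_continuous vP Gc (i := i) (x := r0).
pose t := Num.min d e / 2.
have de0 : 0 < Num.min d e by rewrite lt_min d0.
have t0 : 0 < t by rewrite divr_gt0.
have [td te] : t < d /\ t < e.
  have : t < Num.min d e by rewrite /t; lra.
  by rewrite lt_min => /andP[].
have Gt (r : R) : r0 < r < r0 + t -> G (v r0) 0 i / 2 <= G (v r) 0 i.
  move=> /andP[r1 r2]; have := eP r; rewrite -ball_normE /= ltr_distlC => H.
  have : r0 - e < r < r0 + e by apply/andP; split; lra.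
  by move=> /H; rewrite ltr_distlC => /andP[] /=; lra.
pose s := r0 + t / 2; pose r1 := r0 + t.
have s0 : 0 < s by rewrite /s; lra.
have r1p : 0 < r1 by rewrite /r1; lra.
have Ps : 0 < P s 0 i.
  have := flux_ge vP (a := r0) (b := s) (c := G (v r0) 0 i / 2) r00 _ (i := i).
  move=> /(_ _ _) H; have {}H := H (ltac:(rewrite /s; lra)).
  have : G (v r0) 0 i / 2 * (s ^+ m.+1 - r0 ^+ m.+1) / m.+1%:R <= P s 0 i - P r0 0 i.
    apply: H => r /andP[h1 h2]; apply: Gt; rewrite h1 /=; move: h2; rewrite /s; lra.
  have := flux_ge0 vP G0 i r00.
  have : 0 < G (v r0) 0 i / 2 * (s ^+ m.+1 - r0 ^+ m.+1) / m.+1%:R.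
    rewrite divr_gt0 ?ltr0n // mulr_gt0 // subr_gt0 ltrXn2r ?nnegrE ?(ltW s0) //.
    by rewrite /s; lra.
  move=> h1 h2 h3; have := lt_le_trans h1 h3; rewrite subr_gt0; exact: le_lt_trans.
exists r1; first by rewrite /r1; apply/andP; split; lra.
have := profile_le vP (a := s) (b := r1) (c := r1 ^- m * P s 0 i) (ltW s0) _ (i := i).
move=> /(_ _ _) H; have {}H := H (ltac:(rewrite /s /r1; lra)).
have vs : v s 0 i <= v r0 0 i.
  by apply: (profile_nincr vP G0) => //; rewrite /s; lra.
have c1 : 0 < r1 ^- m * P s 0 i * (r1 - s).
  by rewrite !mulr_gt0 ?invr_gt0 ?exprn_gt0 // /r1 /s; lra.
apply: le_lt_trans (H _) _; last first.
  by rewrite subr_lt0; apply: le_lt_trans c1; exact: le_trans vs vi.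
move=> r /andP[sr rr1]; have r0' : 0 < r by exact: lt_trans sr.
rewrite ler_pM // ?invr_ge0 ?exprn_ge0 ?(ltW r1p) ?(ltW Ps) //.
  by rewrite lef_pV2 ?posrE ?exprn_gt0 // lerXn2r ?nnegrE ?(ltW r0') ?(ltW r1p) // ltW.
by apply: (flux_homo vP G0); rewrite ltW.
Qed.

Section Shooting.
Variables (R : realType) (m L : nat) (F : 'rV[R]_L -> 'rV[R]_L) (a : R).
Hypotheses (L0 : (0 < L)%N) (a0 : 0 < a).
Hypothesis F_orthant : forall u, orthant u -> orthant (F u).
Hypothesis F_cont : {within @orthant R L, continuous F}.
Hypothesis F_nondeg : non_degenerate F.
Hypothesis no_dirichlet : forall r : R, 0 < r ->
   ~ exists (u : 'rV[R]_m.+1 -> 'rV[R]_L) (v : R -> 'rV[R]_L),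
       dirichlet_solution F r u /\ radial_on (closure (eball r)) u v.

Let G u := F (clip a u).
Let a0' : 0 <= a := ltW a0.
Let Gc : continuous G. Proof. exact: comp_clip_continuous. Qed.
Let G0 u i : 0 <= G u 0 i.
Proof. by apply: F_orthant => j; have /andP[] := clip_itv a0' u j. Qed.

Lemma shooting : exists v P M, [/\ 0 <= M, radial_profile m G M v P,
  \sum_i v 0 0 i = a, (forall i, 0 <= v 0 0 i) & forall (r : R) i, 0 <= r -> 0 < v r 0 i].
Proof.
have [M M0 GM] := comp_clip_bounded a0' F_cont.
(* With step [1/(k+1)], [(k+1)^2] steps reach radius [k+1], so every fixed radius is eventually
   covered. *)
have /choice[al alP] : forall k : nat, exists al : 'rV[R]_L,
    [/\ forall i, 0 <= al 0 i, \sum_i al 0 i = a &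
    forall j, gstep R k < al 0 j -> exists b : 'rV[R]_L,
      (forall l, (l <= k.+1 ^ 2)%N ->
        `|(euler m G (gstep R k) al l).1 - (euler m G (gstep R k) b l).1| < gstep R k) /\
      (forall l i, (euler m G (gstep R k) b l).1 0 i <= 0 ->
                   (euler m G (gstep R k) b l).1 0 j <= 0)].
  by move=> k; exact: (approx_point m (k.+1 ^ 2)%N L0 (gstep_gt0 R k) a0 (gstep_gt0 R k) Gc G0 GM).
have [U [UU Uoo]] := @ultraFilterLemma nat \oo _.
have al_itv k i : 0 <= al k 0 i <= a.
  have [h1 h2 _] := alP k; rewrite h1 /= -h2 (bigD1 i) //= lerDl.
  by apply: sumr_ge0 => j _; exact: h1.
have [v [P [vP vU]]] := euler_limit m Gc M0 G0 GM UU Uoo al_itv.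
have PU : ProperFilter U by exact: ultra_proper.
have alv i : al k 0 i @[k --> U] --> v 0 0 i.
  have := vU 0 i; rewrite (_ : (fun k => _) = (fun k => al k 0 i)) //.
  by apply/funext => k; rewrite /gidx normr0 mul0r truncn0.
have v00 i : 0 <= v 0 0 i.
  refine (@ler_cvg_to nat U PU R (cst 0) _ _ _ (@cvg_cst _ _ _ _ _) (alv i) _).
  by apply: nearW => k; have /andP[] := al_itv k i.
have v0a : \sum_i v 0 0 i = a.
  have h : \sum_i al k 0 i @[k --> U] --> \sum_i v 0 0 i.
    by apply: cvg_big => [|i _]; [exact: add_continuous|exact: alv].
  rewrite (_ : (fun k => _) = cst a) in h; last by apply/funext => k; have [_ -> _] := alP k.
  by apply: (cvg_unique _ h) => //; exact: cvg_cst.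
exists v, P, M; split=> // r' i' r'0; rewrite ltNge; apply/negP => vr'.
pose Z := [set r : R | 0 <= r /\ exists i, v r 0 i <= 0].
have Zr' : Z r' by split=> //; exists i'.
have iZ : has_inf Z by split; [exists r'|exists 0 => r []].
pose r0 := inf Z.
have r00 : 0 <= r0 by apply: lb_le_inf; [exists r'|move=> r []].
have before (r : R) i : 0 <= r -> r < r0 -> 0 < v r 0 i.
  move=> rp rr0; rewrite ltNge; apply/negP => vi.
  have : Z r by split=> //; exists i.
  by move=> /(ge_inf iZ.2); rewrite leNgt rr0.
have v_ball (e : R) i : 0 < e -> exists2 d : R, 0 < d &
    forall t, `|r0 - t| < d -> `|v r0 0 i - v t 0 i| < e.
  move=> e0; have /cvgrPdist_lt/(_ _ e0)/nbhs_ballP[d /= d0 dP] :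
    v t 0 i @[t --> r0] --> v r0 0 i by case: vP => + _ _ _ _; exact.
  by exists d => // t td; apply: dP; rewrite -ball_normE.
have at_r0 i : 0 <= v r0 0 i.
  rewrite leNgt; apply/negP => vi; have vi0 : 0 < - v r0 0 i by rewrite oppr_gt0.
  have [r0E|r0p] := leP r0 0.
    have r0z : r0 = 0 by apply/eqP; rewrite eq_le r0E r00.
    by move: vi; rewrite r0z ltNge v00.
  have [d d0 dP] := v_ball _ i vi0.
  pose t := Num.max 0 (r0 - d / 2).
  have tr0 : t < r0 by rewrite gt_max r0p /=; lra.
  have tp : 0 <= t by rewrite le_max lexx.
  have : r0 - d / 2 <= t by rewrite le_max lexx orbT.
  move=> h; have := dP t; rewrite ger0_norm ?subr_ge0 ?(ltW tr0) // => /(_ _) H.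
  have := before t i tp tr0; have := H (ltac:(lra)); rewrite ltr_distlC; lra.
have [i vi] : exists i, v r0 0 i <= 0.
  apply: contrapT => H.
  have H' i : 0 < v r0 0 i by rewrite ltNge; apply/negP => h; apply: H; exists i.
  have : \forall t \near r0, forall i, 0 < v t 0 i.
    apply: (@filter_forall R _ (fun i t => 0 < v t 0 i) (nbhs r0)) => i; have [d d0 dP] := v_ball _ i (H' i).
    apply: filterS (nbhsx_ballx (r0 : R) _ d0) => t; rewrite -ball_normE /= => /dP.
    by rewrite ltr_distlC => /andP[+ _]; lra.
  move=> /nbhs_ballP[d /= d0 dP].
  have [t [tp [j tj]] td] := inf_adherent d0 iZ.
  have : 0 < v t 0 j.
    apply: dP; rewrite -ball_normE /= ltr_distlC -/r0 td andbT.
    have : r0 <= t by apply: (ge_inf iZ.2); split=> //; exists j.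
    by lra.
  by rewrite ltNge tj.
have vi0 : v r0 0 i = 0 by apply/eqP; rewrite eq_le vi at_r0.
have vle (r : R) j : 0 <= r -> v r 0 j <= a.
  move=> rp; apply: le_trans (profile_nincr vP G0 j (lexx 0) rp) _.
  by rewrite -v0a (bigD1 j) //= lerDl; apply: sumr_ge0.
(* The truncation is inactive while all components are nonnegative, since none exceeds its initial
   value. *)
have GF (r : R) : 0 <= r -> (forall j, 0 <= v r 0 j) -> G (v r) = F (v r).
  by move=> rp H; rewrite /G clip_id // => j; rewrite H vle.
have [vz|/existsNP[j /eqP vj]] := pselect (forall j, v r0 0 j = 0).
  have r0p : 0 < r0.
    rewrite lt_def r00 andbT; apply/eqP => r0E.
    have : \sum_j v r0 0 j = 0 by rewrite big1.
    by rewrite r0E v0a => aE; move: a0; rewrite aE ltxx.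
  apply: (no_dirichlet r0p).
  exists (fun x => v (enorm x)), v; split; last by [].
  split; first split.
  - by move=> j x _; exact: (profile_C2 vP Gc j).
  - move=> x xr j; rewrite (profile_laplacian vP Gc) GF ?enorm_ge0 // => l.
    by apply/ltW/before; rewrite ?enorm_ge0.
  - by move=> x xr j; apply: before; rewrite ?enorm_ge0.
  - move=> j; apply: continuous_subspaceT => x.
    by case: (profile_C2 vP Gc j (x := x)).
  - by move=> x /boundary_eball -> j; exact: vz.
have vjp : 0 < v r0 0 j by rewrite lt_def vj at_r0.
have [l vl Fl] : exists2 l, v r0 0 l = 0 & 0 < F (v r0) 0 l.
  by apply: non_degenerate_pos => //; [exists j|exists i].
have Gl : 0 < G (v r0) 0 l by rewrite GF.
have [d d0 dP] := v_ball _ j vjp.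
have [r1 /andP[r01 r1d] vr1] : exists2 r1, r0 < r1 < r0 + d & v r1 0 l < 0.
  by apply: (profile_drops vP Gc G0 r00 d0 _ Gl); rewrite vl.
have r1p : 0 < r1 by exact: le_lt_trans r01.
have vj1 : 0 < v r1 0 j.
  have := dP r1; rewrite distrC gtr0_norm ?subr_gt0 // => /(_ _) H.
  by have := H (ltac:(lra)); rewrite ltr_distlC => /andP[+ _]; lra.
have vj0 : 0 < v 0 0 j.
  exact: lt_le_trans vj1 (profile_nincr vP G0 j (lexx 0) (ltW r1p)).
(* Half of the smallest margin: one [e] pays for the limit along [U], the other for the distance to
   the labelled point [b]. The bound on [v 0 0 j] ensures that [al k 0 j] exceeds the step, so that
   [j] is a label nearby. *)
pose e := Num.min (- v r1 0 l) (Num.min (v r1 0 j) (v 0 0 j)) / 2.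
have [e0 [el [ej ej0]]] : 0 < e /\ v r1 0 l + e + e <= 0 /\ e + e <= v r1 0 j /\ e + e <= v 0 0 j.
  have ee : e + e = Num.min (- v r1 0 l) (Num.min (v r1 0 j) (v 0 0 j)) by rewrite /e; lra.
  split; first by rewrite divr_gt0 // !lt_min oppr_gt0 vr1 vj1.
  have : e + e <= - v r1 0 l by rewrite ee ge_min lexx.
  have : e + e <= v r1 0 j by rewrite ee !ge_min lexx orbT.
  have : e + e <= v 0 0 j by rewrite ee !ge_min lexx !orbT.
  by split; [lra|].
have /cvgrPdist_lt/(_ _ e0) H1 := vU r1 l.
have /cvgrPdist_lt/(_ _ e0) H2 := vU r1 j.
have /cvgrPdist_lt/(_ _ e0) H3 := alv j.
have H4 := gstep_small Uoo e0.
have r1V : 0 < r1^-1 by rewrite invr_gt0.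
have H5 := gstep_small Uoo r1V.
have [k [[[[k1 k2] k3] k4] k5]] := filter_ex (filterI (filterI (filterI (filterI H1 H2) H3) H4) H5).
have [_ _ /(_ j)] := alP k.
move: k3; rewrite ltr_distlC => /andP[k3 _].
case=> [|b [bclose blab]]; first by lra.
have idx : (gidx k r1 <= k.+1 ^ 2)%N.
  rewrite -(ler_nat R); have := gidx_itv k r1; rewrite (gtr0_norm r1p) => /andP[+ _].
  rewrite -[gstep R k *+ _]mulr_natl /gstep ler_pdivrMr ?ltr0n // => h; apply: le_trans h _.
  rewrite natrX expr2 ler_wpM2r //.
  by move: k5; rewrite /gstep ltf_pV2 ?posrE ?ltr0n // => /ltW.
have close i0 := le_lt_trans (coord_norm_le _ i0) (bclose _ idx).
have := close l; have := close j; rewrite !mxE !ltr_distlC => /andP[c1 c2] /andP[c3 c4].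
move: k1 k2; rewrite !ltr_distlC => /andP[k1 k1'] /andP[k2 k2'].
(* From [b], component [l] is nonpositive at this grid point while [j] is still positive, against
   the label [j]. *)
have bl : (euler m G (gstep R k) b (gidx k r1)).1 0 l <= 0 by lra.
by have := blab _ _ bl; lra.
Qed.

Lemma decaying_solution : (forall u : 'rV[R]_L, all_pos u -> \sum_i u 0 i <= a -> F u <> 0) ->
  exists (u : 'rV[R]_m.+1 -> 'rV[R]_L) (v : R -> 'rV[R]_L),
     [/\ entire_solution F u, radial_on setT u v & v r @[r --> +oo] --> (0 : 'rV[R]_L)].
Proof.
move=> Fne; have [v [P [M [M0 vP v0a v00 vpos]]]] := shooting.
have vle (r : R) j : 0 <= r -> v r 0 j <= a.
  move=> rp; apply: le_trans (profile_nincr vP G0 j (lexx 0) rp) _.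
  by rewrite -v0a (bigD1 j) //= lerDl; apply: sumr_ge0.
exists (fun x => v (enorm x)), v; split=> //.
  split.
  - by move=> i; exact: (profile_C2 vP Gc i).
  - move=> x _ i; rewrite (profile_laplacian vP Gc) /G clip_id // => j.
    by rewrite vle ?enorm_ge0 // andbT; apply/ltW/vpos; exact: enorm_ge0.
  - by move=> x _ i; apply: vpos; exact: enorm_ge0.
have [l [vl lv Gl]] := profile_limit vP Gc G0 (fun r i rp => ltW (vpos r i rp)).
have lo : orthant l by move=> i; have /andP[] := lv 0 i (lexx 0).
have Fl i : F l 0 i = 0.
  rewrite -(Gl i) /G clip_id // => j; rewrite lo /=.
  by have /andP[_ h] := lv 0 j (lexx 0); apply: le_trans h (vle _ _ (lexx 0)).
suff -> : (0 : 'rV[R]_L) = l by [].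
apply/esym/rowP => i; rewrite mxE; apply/eqP; apply: contraT => li.
have lip : 0 < l 0 i by rewrite lt_def li lo.
(* A limit with all components positive is excluded by the hypothesis, as its component sum is at
   most [a]; a limit with both positive and zero components is excluded by non-degeneracy. *)
have [lp|/existsNP[j /negP]] := pselect (forall j, 0 < l 0 j).
  exfalso; apply: (Fne l lp); last by apply/rowP => j; rewrite Fl mxE.
  by rewrite -v0a; apply: ler_sum => j _; have /andP[] := lv 0 j (lexx 0).
rewrite -leNgt => lj; have lj0 : l 0 j = 0 by apply/eqP; rewrite eq_le lj lo.
have [|k _] := non_degenerate_pos F_nondeg lo _ (ex_intro _ j lj0); first by exists i.
by rewrite Fl ltxx.
Qed.

End Shooting.

Theorem theorem2 (R : realType) (n L : nat) (hn : (1 <= n)%N) (hL : (1 <= L)%N)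
    (F : 'rV[R]_L -> 'rV[R]_L)
    (F_orthant : forall u, orthant u -> orthant (F u))
    (F_cont : {within @orthant R L, continuous F})
    (F_lip : locally_lipschitz_on (@orthant R L)° F)
    (F_nondeg : non_degenerate F)
    (no_dirichlet : forall r : R, 0 < r ->
       ~ exists (u : 'rV[R]_n -> 'rV[R]_L) (v : R -> 'rV[R]_L),
           dirichlet_solution F r u /\ radial_on (closure (eball r)) u v) :
  (exists (u : 'rV[R]_n -> 'rV[R]_L) (v : R -> 'rV[R]_L),
     entire_solution F u /\ radial_on setT u v) /\
  ((exists2 eps : R, 0 < eps &
      forall u : 'rV[R]_L, all_pos u -> enorm u < eps -> F u <> 0) ->
   exists (u : 'rV[R]_n -> 'rV[R]_L) (v : R -> 'rV[R]_L),
     [/\ entire_solution F u, radial_on setT u v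
       & v r @[r --> +oo] --> (0 : 'rV[R]_L)]).
Proof.
case: n hn no_dirichlet => // m _ no_dirichlet.
have decay (eps : R) : 0 < eps ->
    (forall u : 'rV[R]_L, all_pos u -> enorm u < eps -> F u <> 0) ->
  exists (u : 'rV[R]_m.+1 -> 'rV[R]_L) (v : R -> 'rV[R]_L),
     [/\ entire_solution F u, radial_on setT u v & v r @[r --> +oo] --> (0 : 'rV[R]_L)].
  (* On the orthant the Euclidean norm is at most the component sum, so mass [eps / 2] stays
     strictly inside the ball of radius [eps]. *)
  move=> eps0 Fne; have a0 : 0 < eps / 2 by rewrite divr_gt0.
  apply: (decaying_solution hL a0 F_orthant F_cont F_nondeg no_dirichlet) => u up us.
  apply: Fne => //; apply: le_lt_trans (enorm_le_sum _) _ => [i|]; first exact: ltW.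
  by apply: le_lt_trans us _; lra.
split; last by case=> eps; exact: decay.
(* A positive zero of [F] is a constant solution; if there is none, the decay argument applies with
   any [eps], for instance 1. *)
have [[u0 [u0p Fu0]]|H] := pselect (exists u0 : 'rV[R]_L, all_pos u0 /\ F u0 = 0).
  exists (cst u0), (cst u0); split=> //; split=> [i|x _ i|x _ //].
    exact: (cst_C2 m.+1 (u0 0 i)).1.
  by rewrite Fu0 mxE; exact: (cst_C2 m.+1 (u0 0 i)).2.
have [u [v [uF uv _]]] : exists (u : 'rV[R]_m.+1 -> 'rV[R]_L) (v : R -> 'rV[R]_L),
     [/\ entire_solution F u, radial_on setT u v & v r @[r --> +oo] --> (0 : 'rV[R]_L)].
  by apply: (decay 1) => // u up _ Fu; apply: H; exists u.
by exists u, v.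
Qed.
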